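(* Let $(\bar A,\bar C)$ be a structurally observable structured system with $\bar A\in\{0,*\}^{n\times n}$, $\bar C\in\{0,*\}^{r\times n}$, every row of $\bar C$ nonzero, and suppose that the matching deficiency $n-\mathrm{grank}(\bar A)$ is bounded by a fixed constant $\bar k_s$ (as $n$ and $r$ increase). Then Algorithm 2 (described in the context) provides an optimal solution to the problem $$\min_{S\subseteq V}|S|\quad\text{s.t. } (\bar A,\bar C_{V\setminus S})\ \text{is structurally unobservable},\qquad V=\{1,\dots,r\},$$ with time complexity at most $O((r+n)^{2.373}r^{\bar k_s})$.
   Context: A structured matrix is a matrix whose entries are either fixed zeros or free (mutually independent) parameters $*$; $\{0,*\}^{a\times b}$ is the set of such $a\times b$ matrices. The generic rank $\mathrm{grank}(M)$ is the maximum rank of $M$ over all values of its free parameters; it equals the maximum matching size of the bipartite graph whose left/right vertices are the rows/columns of $M$ and whose edges are the nonzero entries of $M$. $(\bar A,\bar C)$ is structurally observable if some numerical realization (real matrices with the same sparsity pattern) is observable for the system $\dot x=Ax$, $y=Cx$; otherwise it is structurally unobservable. $\bar C_J$ is the submatrix of rows indexed by $J$, and $\mathbf{col}\{X,Y\}$ stacks $X$ on top of $Y$. Digraphs: $\mathcal D(\bar A)$ has vertices $x_1,\dots,x_n$ and an edge $(x_i,x_j)$ whenever $\bar A_{ji}\neq0$; $\mathcal D(\bar A,\bar C)$ additionally has vertices $y_1,\dots,y_r$ and an edge $(x_j,y_i)$ whenever $\bar C_{ij}\ne0$. A sink strongly connected component (sink SCC) of $\mathcal D(\bar A)$ is a strongly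 connected component with no outgoing edge to any other strongly connected component of $\mathcal D(\bar A)$. Complexity convention: a maximum matching (hence a generic rank) for the bipartite graph of a matrix $\mathbf{col}\{\bar A,\bar C_J\}$ is computed in $O((r+n)^{2.373})$ time. Algorithm 2. (1) Find all sink SCCs $\mathcal N_1,\dots,\mathcal N_l$ of $\mathcal D(\bar A)$; let $J^y_i$ be the set of indices $j$ such that $y_j$ is an out-neighbor in $\mathcal D(\bar A,\bar C)$ of some vertex of $\mathcal N_i$; let $J^y_{re}$ be a set of minimum cardinality among $J^y_1,\dots,J^y_l$. (2) Let $\tau_m=n-\mathrm{grank}(\bar A)$. If $\tau_m=0$, set $J^y_{ma}=V$. If $\tau_m>0$, build a tree of subsets of $V$, layer by layer, for $\tau=0,\dots,\tau_m-1$: layer $0$ starts from the single set $T^0_1=\emptyset$; in layer $\tau$, given sets $T^\tau_1,\dots,T^\tau_{L_{\tau-1}}$ (with $L_{-1}=1$), for each $i$ set $$\bar T^\tau_i=T^\tau_i\cup\{j\in V\setminus T^\tau_i:\ \mathrm{grank}(\mathbf{col}\{\bar A,\bar C_{T^\tau_i\cup\{j\}}\})=\mathrm{grank}(\mathbf{col}\{\bar A,\bar C_{T^\tau_i}\})\},\quad \Omega^\tau_i=V\setminus\bar T^\tau_i,$$ and let the children of node $i$ be the sets $\bar T^\tau_i\cup\{j\}$, $j\in\Omega^\tau_i$; the sets $T^{\tau+1}_1,\dots,T^{\tau+1}_{L_\tau}$ are all children of all nodes of layer $\tau$, $L_\tau=\sum_i|\Omega^\tau_i|$. Let $T_{\max}$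 be a set of maximum cardinality among $\bar T^{\tau_m-1}_1,\dots,\bar T^{\tau_m-1}_{L_{\tau_m-2}}$ and $J^y_{ma}=V\setminus T_{\max}$. (3) Return $J_{opt}$, a set of minimum cardinality among $J^y_{ma}$ and $J^y_{re}$. *)

(* Defs.v *)
From mathcomp Require Import all_boot all_order all_algebra.
From mathcomp Require Import boolp reals topology normedtype derive exp.

Set Implicit Arguments.
Unset Strict Implicit.
Unset Printing Implicit Defensive.

Import Order.TTheory GRing.Theory Num.Theory.
Import numFieldNormedType.Exports.

Local Open Scope ring_scope.

(** A structured matrix is an ['M[bool]_(m, p)]: [false] is a fixed zero and
    [true] a free parameter [*]. *)

(** [X] arises from [M] by giving arbitrary values, possibly zero, to the free
    parameters. *)
Definition parameter_values (R : realType) m p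
    (M : 'M[bool]_(m, p)) (X : 'M[R]_(m, p)) : Prop :=
  forall i j, ~~ M i j -> X i j = 0.

(** The bound in the maximum is the largest rank of any m x p matrix. *)
Definition grank (R : realType) m p (M : 'M[bool]_(m, p)) : nat :=
  \max_(k < (minn m p).+1
        | `[< exists X : 'M[R]_(m, p), parameter_values M X /\ \rank X = k >]) k.

Definition same_sparsity (R : realType) m p
    (M : 'M[bool]_(m, p)) (X : 'M[R]_(m, p)) : Prop :=
  forall i j, M i j = (X i j != 0).

Definition solves (R : realType) n (A : 'M[R]_n) (x : R -> 'cV[R]_n) : Prop :=
  forall (t : R) (i : 'I_n),
    is_derive t (1 : R) (fun s : R => x s i ord0) ((A *m x t) i ord0).

(** The output [C x] on [0, +oo) determines the initial state.  Trajectories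
    are taken on the whole line; every solution of the linear system on
    [0, +oo) extends uniquely to it. *)
Definition observable (R : realType) n m
    (A : 'M[R]_n) (C : 'M[R]_(m, n)) : Prop :=
  forall x1 x2 : R -> 'cV[R]_n, solves A x1 -> solves A x2 ->
    (forall t, 0 <= t -> C *m x1 t = C *m x2 t) -> x1 0 = x2 0.

Definition struct_observable (R : realType) n m
    (A : 'M[bool]_n) (C : 'M[bool]_(m, n)) : Prop :=
  exists (A0 : 'M[R]_n) (C0 : 'M[R]_(m, n)),
    [/\ same_sparsity A A0, same_sparsity C C0 & observable A0 C0].

Definition struct_unobservable (R : realType) n m
    (A : 'M[bool]_n) (C : 'M[bool]_(m, n)) : Prop :=
  ~ struct_observable R A C.

Definition subrows n r (C : 'M[bool]_(r, n)) (J : {set 'I_r}) :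
    'M[bool]_(#|J|, n) :=
  rowsub (fun i : 'I_#|J| => enum_val i) C.

Definition colAC n r (A : 'M[bool]_n) (C : 'M[bool]_(r, n)) (J : {set 'I_r}) :
    'M[bool]_(n + #|J|, n) :=
  col_mx A (subrows C J).

Definition feasible (R : realType) n r
    (A : 'M[bool]_n) (C : 'M[bool]_(r, n)) (S : {set 'I_r}) : Prop :=
  struct_unobservable R A (subrows C (~: S)).

Definition optimal (R : realType) n r
    (A : 'M[bool]_n) (C : 'M[bool]_(r, n)) (S : {set 'I_r}) : Prop :=
  feasible R A C S /\
  forall S' : {set 'I_r}, feasible R A C S' -> (#|S| <= #|S'|)%N.

(** * The algorithm as a relation between inputs and admissible outputs
    (ties between sets of extremal cardinality are broken arbitrarily). *)

(** Edge (x_i, x_j) whenever the entry (j, i) of [A] is nonzero. *)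
Definition state_digraph n (A : 'M[bool]_n) : rel 'I_n := fun i j => A j i.

Definition is_scc n (A : 'M[bool]_n) (N : {set 'I_n}) : Prop :=
  exists x : 'I_n,
    N = [set y | connect (state_digraph A) x y && connect (state_digraph A) y x].

Definition is_sink_scc n (A : 'M[bool]_n) (N : {set 'I_n}) : Prop :=
  is_scc A N /\
  forall u v : 'I_n, u \in N -> v \notin N -> ~~ state_digraph A u v.

Definition out_sensors n r (C : 'M[bool]_(r, n)) (N : {set 'I_n}) :
    {set 'I_r} :=
  [set j | [exists x in N, C j x]].

Definition is_Jre n r (A : 'M[bool]_n) (C : 'M[bool]_(r, n))
    (J : {set 'I_r}) : Prop :=
  (exists2 N, is_sink_scc A N & J = out_sensors C N) /\
  (forall N, is_sink_scc A N -> (#|J| <= #|out_sensors C N|)%N).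

Definition deficiency (R : realType) n (A : 'M[bool]_n) : nat :=
  (n - grank R A)%N.

Definition Tbar (R : realType) n r (A : 'M[bool]_n) (C : 'M[bool]_(r, n))
    (T : {set 'I_r}) : {set 'I_r} :=
  T :|: [set j in ~: T |
          grank R (colAC A C (j |: T)) == grank R (colAC A C T)].

Definition children (R : realType) n r (A : 'M[bool]_n) (C : 'M[bool]_(r, n))
    (T : {set 'I_r}) : seq {set 'I_r} :=
  [seq j |: Tbar R A C T | j <- enum (~: Tbar R A C T)].

Fixpoint tree_layer (R : realType) n r (A : 'M[bool]_n) (C : 'M[bool]_(r, n))
    (tau : nat) : seq {set 'I_r} :=
  if tau is tau'.+1 then
    flatten [seq children R A C T | T <- tree_layer R A C tau']
  else [:: set0].

Definition closed_layer (R : realType) n r (A : 'M[bool]_n)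
    (C : 'M[bool]_(r, n)) (tau : nat) : seq {set 'I_r} :=
  [seq Tbar R A C T | T <- tree_layer R A C tau].

Definition is_Jma (R : realType) n r (A : 'M[bool]_n) (C : 'M[bool]_(r, n))
    (J : {set 'I_r}) : Prop :=
  if deficiency R A is tau.+1 then
    exists Tmax : {set 'I_r},
      [/\ Tmax \in closed_layer R A C tau,
          forall T, T \in closed_layer R A C tau -> (#|T| <= #|Tmax|)%N
        & J = ~: Tmax]
  else J = setT.

Definition algorithm_output (R : realType) n r (A : 'M[bool]_n)
    (C : 'M[bool]_(r, n)) (Jopt : {set 'I_r}) : Prop :=
  exists Jma Jre : {set 'I_r},
    [/\ is_Jma R A C Jma, is_Jre A C Jre,
        Jopt \in [:: Jma; Jre], (#|Jopt| <= #|Jma|)%N & (#|Jopt| <= #|Jre|)%N].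

(** * An implementation with running time

    A computation returns its result together with the number of elementary
    steps it takes.  A subset of ['I_m] stands for an array of m bits, so
    that reading or setting one bit takes one step, while creating, copying,
    complementing or measuring a set takes m steps. *)

Definition timed (T : Type) : Type := (T * nat)%type.

Definition steps (k : nat) T (x : T) : timed T := (x, k).

Definition ret T (x : T) : timed T := steps 0 x.

Definition bind T U (m : timed T) (f : T -> timed U) : timed U :=
  let y := f m.1 in (y.1, (m.2 + y.2)%N).

Notation "'let*' x := m 'in' k" := (bind m (fun x => k))
  (at level 200, x name, m at level 200, k at level 200,
   format "'[v' 'let*'  x  :=  m  'in' '/' k ']'").

(** Each iteration takes one step in addition to its body. *)
Fixpoint for_each X S (s : seq X) (body : X -> S -> timed S) (st : S) :
    timed S :=
  if s is x :: s' then
    let* tick := steps 1 tt in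
    let* st' := body x st in
    for_each s' body st'
  else ret st.

Definition entry m p (M : 'M[bool]_(m, p)) i j : timed bool := steps 1 (M i j).
Definition less (a b : nat) : timed bool := steps 1 (a < b)%N.
Definition same (a b : nat) : timed bool := steps 1 (a == b).
Definition minus (a b : nat) : timed nat := steps 1 (a - b)%N.

Definition test m (x : 'I_m) (S : {set 'I_m}) : timed bool := steps 1 (x \in S).
(** In place: every call below is on a set that is not used afterwards. *)
Definition insert m (x : 'I_m) (S : {set 'I_m}) : timed {set 'I_m} :=
  steps 1 (x |: S).
Definition copy m (S : {set 'I_m}) : timed {set 'I_m} := steps m S.
Definition compl m (S : {set 'I_m}) : timed {set 'I_m} := steps m (~: S).
Definition card m (S : {set 'I_m}) : timed nat := steps m #|S|.
Definition new_empty m : timed {set 'I_m} := steps m set0.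
Definition new_full m : timed {set 'I_m} := steps m setT.

Definition smallest m (s : seq {set 'I_m}) (S0 : {set 'I_m}) :
    timed {set 'I_m} :=
  for_each s (fun S best =>
    let* a := card S in
    let* b := card best in
    let* lt := less a b in
    ret (if lt then S else best)) S0.

Definition largest m (s : seq {set 'I_m}) (S0 : {set 'I_m}) :
    timed {set 'I_m} :=
  for_each s (fun S best =>
    let* a := card S in
    let* b := card best in
    let* lt := less b a in
    ret (if lt then S else best)) S0.

(** Adds to [vis] the vertices reachable from [w] without entering [vis].
    A vertex is pushed on the stack only when it is first visited, so that n
    rounds empty the stack. *)
Definition search n (edge : 'I_n -> 'I_n -> timed bool) (w : 'I_n)
    (vis : {set 'I_n}) : timed {set 'I_n} :=
  let* vis0 := insert w vis in
  let* st := for_each (enum 'I_n) (fun _ st =>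
    if st.1 is u :: stack then
      for_each (enum 'I_n) (fun v st' =>
        let* b := edge u v in
        let* seen := test v st'.2 in
        if b && ~~ seen then
          let* vis' := insert v st'.2 in ret (v :: st'.1, vis')
        else ret st') (stack, st.2)
    else ret st) ([:: w], vis0) in
  ret st.2.

Definition forward n (A : 'M[bool]_n) (u v : 'I_n) : timed bool := entry A v u.
Definition backward n (A : 'M[bool]_n) (u v : 'I_n) : timed bool := entry A u v.

(** Backward searches from those vertices of [order] not yet visited when their
    turn comes; returns the starting points, the last one first. *)
Definition search_roots n (A : 'M[bool]_n) (order : seq 'I_n) :
    timed (seq 'I_n) :=
  let* vis0 := new_empty n in
  let* st := for_each order (fun v st =>
    let* seen := test v st.2 in
    if seen then ret st
    else
      let* vis := search (backward A) v st.2 in ret (v :: st.1, vis))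
    ([::], vis0) in
  ret st.1.

(** After the first pass, every vertex is reachable backwards from some root, and
    no root is reachable backwards from an earlier one.  The second pass, over
    the roots in reverse order, thus keeps only those reachable backwards from
    no other root: exactly one vertex in each sink component.  The component
    consists of the vertices reachable (forwards) from it. *)
Definition sink_sccs n (A : 'M[bool]_n) : timed (seq {set 'I_n}) :=
  let* roots := search_roots A (enum 'I_n) in
  let* reps := search_roots A roots in
  for_each reps (fun w acc =>
    let* vis0 := new_empty n in
    let* N := search (forward A) w vis0 in
    ret (N :: acc)) [::].

Definition sensors_of n r (C : 'M[bool]_(r, n)) (N : {set 'I_n}) :
    timed {set 'I_r} :=
  let* J0 := new_empty r in
  for_each (enum 'I_n) (fun x J =>
    let* inN := test x N in
    if inN then
      for_each (enum 'I_r) (fun j J' =>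
        let* c := entry C j x in
        if c then insert j J' else ret J') J
    else ret J) J0.

(** [V] has maximum cardinality, so it is a neutral starting point. *)
Definition compute_Jre n r (A : 'M[bool]_n) (C : 'M[bool]_(r, n)) :
    timed {set 'I_r} :=
  let* Ns := sink_sccs A in
  let* Js := for_each Ns (fun N acc =>
    let* J := sensors_of C N in ret (J :: acc)) [::] in
  let* V := new_full r in
  smallest Js V.

(** A procedure computing generic ranks of the matrices [colAC A C J]. *)
Definition grank_procedure : Type :=
  forall n r : nat, 'M[bool]_n -> 'M[bool]_(r, n) -> {set 'I_r} -> timed nat.

Definition compute_Tbar (gr : grank_procedure) n r (A : 'M[bool]_n)
    (C : 'M[bool]_(r, n)) (T : {set 'I_r}) : timed {set 'I_r} :=
  let* g := gr n r A C T in
  let* B0 := copy T in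
  for_each (enum 'I_r) (fun j B =>
    let* inT := test j T in
    if inT then ret B
    else
      let* T1 := copy T in
      let* Tj := insert j T1 in
      let* gj := gr n r A C Tj in
      let* eq := same gj g in
      if eq then insert j B else ret B) B0.

(** From the closed sets of one layer of the tree to those of the next. *)
Definition next_closed_layer (gr : grank_procedure) n r (A : 'M[bool]_n)
    (C : 'M[bool]_(r, n)) (Bs : seq {set 'I_r}) : timed (seq {set 'I_r}) :=
  for_each Bs (fun B acc =>
    for_each (enum 'I_r) (fun j acc' =>
      let* inB := test j B in
      if inB then ret acc'
      else
        let* B1 := copy B in
        let* T := insert j B1 in
        let* Tb := compute_Tbar gr A C T in
        ret (Tb :: acc')) acc) [::].

Definition compute_Jma (gr : grank_procedure) n r (A : 'M[bool]_n)
    (C : 'M[bool]_(r, n)) : timed {set 'I_r} :=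
  let* E := new_empty r in
  let* g := gr n r A C E in
  let* tau_m := minus n g in
  if tau_m is tau.+1 then
    let* B := compute_Tbar gr A C E in
    let* Bs := for_each (iota 0 tau)
                 (fun _ Bs => next_closed_layer gr A C Bs) [:: B] in
    let* Tmax := largest Bs E in
    compl Tmax
  else new_full r.

Definition algorithm (gr : grank_procedure) n r (A : 'M[bool]_n)
    (C : 'M[bool]_(r, n)) : timed {set 'I_r} :=
  let* Jre := compute_Jre A C in
  let* Jma := compute_Jma gr A C in
  smallest [:: Jre] Jma.

Definition result T (m : timed T) : T := m.1.
Definition time T (m : timed T) : nat := m.2.

(* Main.v *)
(** A real system (A, C) is unobservable as soon as the complexification of A has an
    eigenvector in the kernel of C, and it is observable when the Kalman matrix
    has full column rank; a failure of the latter again gives such an eigenvector,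
    because the unobservable subspace is invariant.  Hence structural observability
    amounts to two conditions: every state reaches an output in the digraph, and
    col(A, C) has generic rank n.  For sufficiency, a matching of the n columns
    decomposes the states into paths ending in outputs and cycles; starting from
    the paths, cycles are attached one at a time by an edge into the part already
    built, with weights increasing so that no two cycles share an eigenvalue.
    Perturbing along a segment then makes all free parameters nonzero.

    To destroy reachability one must remove all sensors of some sink component.
    To destroy the rank condition one must keep a set of rank less than n in the
    matroid of the rows of C modulo those of A for one realization that is
    simultaneously generic for all sensor sets.  The tree lists the closed sets by
    rank; given a kept set J of deficient rank, one descends through closed sets T
    for which T and J together still have deficient rank, and the last of these
    contains J. *)
Require Import Defs.
From mathcomp Require Import all_boot all_order perm all_algebra.
From mathcomp Require Import boolp functions reals sequences topology
  normedtype derive exp realfun trigo.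
From mathcomp Require Import complex ring zify.
From mathcomp Require classical_sets.

Set Implicit Arguments.
Unset Strict Implicit.
Unset Printing Implicit Defensive.

Import Order.TTheory GRing.Theory Num.Theory.
Import numFieldNormedType.Exports.

Local Open Scope ring_scope.

(** * Eigenvectors and ranks *)

(** By Cayley-Hamilton the product of the factors [A - z], over the roots [z] of the characteristic
    polynomial, kills [v]. Applying them one by one, the last nonzero vector is an eigenvector, and
    each application preserves [P]. *)
Lemma invariant_eigenvector (F : closedFieldType) n (A : 'M[F]_n)
    (P : 'cV[F]_n -> Prop) (v : 'cV[F]_n) :
    (forall x z, P x -> P (A *m x - z *: x)) -> P v -> v != 0 ->
  exists x z, [/\ P x, x != 0 & A *m x = z *: x].
Proof.
case: n => [|n] in A P v *; first by move=> _ _; rewrite flatmx0 eqxx.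
move=> AP Pv v0.
have [s char_s] := closed_field_poly_normal (char_poly A).
have := Cayley_Hamilton A.
rewrite char_s (monicP (char_poly_monic A)) scale1r => /(congr1 (fun B => B *m v)).
rewrite mul0mx; elim: s v Pv v0 {char_s} => [|z s IHs] v Pv v0.
  by rewrite big_nil rmorph1 mul1mx => /eqP; rewrite (negPf v0).
rewrite big_cons mulrC rmorphM /= -mulmxE -mulmxA rmorphB /= horner_mx_X horner_mx_C.
rewrite mulmxBl mul_scalar_mx.
have [Avz|Avz] := eqVneq (A *m v - z *: v) 0; last by apply: IHs => //; apply: AP.
by move=> _; exists v, z; split=> //; apply/eqP; rewrite -subr_eq0 Avz.
Qed.

Lemma exists_nonroot (R : numDomainType) (p : {poly R}) : p != 0 ->
  exists t, p.[t] != 0.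
Proof.
move=> p0; pose s : seq R := [seq i%:R | i <- iota 0 (size p)].
have us : uniq s by rewrite map_inj_uniq ?iota_uniq //; exact: mulrIn (oner_neq0 R).
have /allPn[t _ pt] : ~~ all (root p) s.
  by apply/negP => /(max_poly_roots p0)/(_ us); rewrite size_map size_iota ltnn.
by exists t.
Qed.

(** An invertible submatrix of maximal size at [t0] has a polynomial determinant [p]; wherever [p]
    does not vanish, the same submatrix bounds the rank from below. *)
Lemma rank_le_specialization (F : fieldType) m n (M : 'M[{poly F}]_(m, n)) (t0 : F) :
  exists2 p : {poly F}, p.[t0] != 0 &
    forall t, p.[t] != 0 ->
      (\rank (map_mx (horner_eval t0) M) <= \rank (map_mx (horner_eval t) M))%N.
Proof.
set N := fun t => map_mx (horner_eval t) M.
pose B := rowsub (maxrankfun (N t0)) (N t0).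
have fullBT : row_full B^T.
  by rewrite /row_full mxrank_tr; exact: (maxrowsub_free (N t0)).
pose f := maxrankfun (N t0); pose g := fullrankfun fullBT.
pose M' := rowsub g (rowsub f M)^T.
exists (\det M') => [|t]; rewrite -!horner_evalE -det_map_mx.
  have -> : map_mx (horner_eval t0) M' = rowsub g B^T.
    by apply/matrixP => i j; rewrite !mxE.
  by rewrite -unitfE -unitmxE fullrowsub_unit.
move=> d0; have : \rank (map_mx (horner_eval t) M') = \rank (N t0).
  by apply: mxrank_unit; rewrite unitmxE unitfE.
move=> <-.
have -> : map_mx (horner_eval t) M' = rowsub g (rowsub f (N t))^T.
  by apply/matrixP => i j; rewrite !mxE.
apply: leq_trans (mxrankS (rowsub_sub _ _)) _.
by rewrite mxrank_tr; apply: mxrankS (rowsub_sub _ _).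
Qed.

(** A rank attained at one point of the segment from [X] to [Y] is attained at all
    but finitely many of its points; this replaces generic values of the
    parameters. *)
Definition interpol (F : fieldType) m n (X Y : 'M[F]_(m, n)) :
    'M[{poly F}]_(m, n) :=
  map_mx polyC X + 'X *: map_mx polyC (Y - X).

Lemma interpolE (F : fieldType) m n (X Y : 'M[F]_(m, n)) t :
  map_mx (horner_eval t) (interpol X Y) = X + t *: (Y - X).
Proof.
by apply/matrixP => i j; rewrite !mxE /horner_eval !hornerE.
Qed.

Lemma interpol0 (F : fieldType) m n (X Y : 'M[F]_(m, n)) :
  map_mx (horner_eval 0) (interpol X Y) = X.
Proof. by rewrite interpolE scale0r addr0. Qed.

Lemma interpol1 (F : fieldType) m n (X Y : 'M[F]_(m, n)) :
  map_mx (horner_eval 1) (interpol X Y) = Y.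
Proof. by rewrite interpolE scale1r addrC subrK. Qed.

(** The observability matrix, with rows indexed by pairs of an exponent below [n] and an output. The
    ring is arbitrary so that the matrix can be formed over polynomials and then specialized. *)
Definition kalman (K : pzRingType) n m (A : 'M[K]_n) (C : 'M[K]_(m, n)) :
    'M[K]_(#|{: 'I_n * 'I_m}|, n) :=
  \matrix_(p < #|{: 'I_n * 'I_m}|, j < n)
    (C *m iter (enum_val p).1 (mulmx A) 1%:M) (enum_val p).2 j.

(** Exponents from [n] on are reduced to smaller ones by Cayley-Hamilton, replacing ['X^k] by its
    remainder modulo the characteristic polynomial. *)
Lemma kalman_eq0 (K : fieldType) n m (A : 'M[K]_n) (C : 'M[K]_(m, n)) (v : 'cV_n) :
  kalman A C *m v = 0 <->
  forall k, C *m iter k (mulmx A) v = 0.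
Proof.
have iterE k (w : 'cV_n) : iter k (mulmx A) w = iter k (mulmx A) 1%:M *m w.
  by elim: k => [|k IHk] /=; rewrite ?mul1mx // IHk mulmxA.
have KvE (p : 'I_#|{: 'I_n * 'I_m}|) :
    (kalman A C *m v) p 0 = (C *m iter (enum_val p).1 (mulmx A) v) (enum_val p).2 0.
  by rewrite iterE mulmxA [LHS]mxE [RHS]mxE; apply: eq_bigr => j _; rewrite mxE.
split=> [Kv k|Cv]; last by apply/matrixP => p q; rewrite ord1 KvE Cv !mxE.
have Cv (i : 'I_n) : C *m iter i (mulmx A) v = 0.
  apply/matrixP => a b; rewrite ord1.
  by have := KvE (enum_rank (i, a)); rewrite enum_rankK Kv !mxE /= => <-.
clear KvE.
case: n => [|n] in A C v Kv Cv iterE *; first by rewrite [X in _ *m X]flatmx0 mulmx0.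
have -> : iter k (mulmx A) v = horner_mx A 'X^k *m v.
  rewrite iterE; congr (_ *m _); elim: k => [|k IHk] /=;
    first by rewrite expr0 (rmorph1 (horner_mx A)).
  by rewrite exprS rmorphM /= horner_mx_X IHk.
rewrite (divp_eq 'X^k (char_poly A)) rmorphD rmorphM /= Cayley_Hamilton mulr0 add0r.
have : (size ('X^k %% char_poly A)%R <= n.+1)%N.
  by rewrite -ltnS -(size_char_poly A) ltn_modp monic_neq0 // char_poly_monic.
move: (_ %% _) => q szq; rewrite -[q]coefK poly_def.
rewrite rmorph_sum /= mulmx_suml mulmx_sumr big1 // => i _.
have lin : (i < n.+1)%N by exact: leq_trans (ltn_ord i) szq.
have -> : horner_mx A (q`_i *: 'X^i) *m v = q`_i *: iter i (mulmx A) v.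
  rewrite linearZ /= -scalemxAl; congr (_ *: _); rewrite iterE; congr (_ *m _).
  elim: (i : nat) => [|l IHl] /=; first by rewrite expr0 (rmorph1 (horner_mx A)).
  by rewrite exprS rmorphM /= horner_mx_X IHl.
by rewrite -scalemxAr (Cv (Ordinal lin)) scaler0.
Qed.

Lemma map_kalman (K L : nzRingType) (f : {rmorphism K -> L}) n m
    (A : 'M[K]_n) (C : 'M[K]_(m, n)) :
  map_mx f (kalman A C) = kalman (map_mx f A) (map_mx f C).
Proof.
apply/matrixP => p j; rewrite !mxE rmorph_sum /=; apply: eq_bigr => k _.
rewrite rmorphM !mxE; congr (_ * _).
suff <- i : map_mx f (iter i (mulmx A) 1%:M) = iter i (mulmx (map_mx f A)) 1%:M by rewrite mxE.
by elim: i => [|i IHi] /=; rewrite ?map_mx1 // map_mxM IHi.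
Qed.

(** * Observability of linear differential equations *)

Section RightDerivative.
Import classical_sets.

(** The right-hand difference quotient already determines the derivative. Outputs are compared only
    on a half-line, and its endpoint matters. *)
Lemma is_derive_zero_right (R : realType) (g : R -> R) (t l : R) :
  is_derive t (1 : R) g l -> (forall s, t <= s -> g s = 0) -> l = 0.
Proof.
move=> [dg <-] g0.
set q := fun h : R => h^-1 *: ((g \o shift t) (h *: (1 : R)) - g t).
have cvq : (q @ 0^'+ --> 'D_1 g t)%classic by apply: cvg_dnbhs_at_right.
apply: (cvg_unique _ cvq) => //.
apply: cvg_near_cst; near=> h.
have h0 : 0 < h by near: h; exact: nbhs_right_gt.
by rewrite /q /= !g0 ?subrr ?scaler0 // [h *: 1]mulr1 lerDr ltW.
Unshelve. all: by end_near. Qed.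

End RightDerivative.

Lemma is_derive_output (R : realType) n m (A : 'M[R]_n) (C : 'M[R]_(m, n))
    (x : R -> 'cV[R]_n) t i :
  solves A x ->
  is_derive t (1 : R) (fun s => (C *m x s) i 0) ((C *m (A *m x t)) i 0).
Proof.
move=> Ax; rewrite mxE.
rewrite (_ : (fun s => _) = \sum_j (C i j \*: (fun s => x s j 0))); last first.
  by apply/funext => s; rewrite mxE fct_sumE; apply: eq_bigr => j _.
by apply: is_derive_sum => j; exact: is_deriveZ.
Qed.

(** The difference [d] of two trajectories with equal outputs is a trajectory with zero output;
    differentiating [k] times gives [C A^k d = 0], in particular at time 0. *)
Lemma observable_kalman (R : realType) n m (A : 'M[R]_n) (C : 'M[R]_(m, n)) :
  (forall v : 'cV_n, (forall k, C *m iter k (mulmx A) v = 0) -> v = 0) ->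
  observable A C.
Proof.
move=> kal x1 x2 Ax1 Ax2 C12.
pose d t := x1 t - x2 t.
have Ad : solves A d.
  move=> t i; rewrite mulmxBr.
  rewrite (_ : (fun s => _) = (fun s => x1 s i ord0) - (fun s => x2 s i ord0)); last first.
    by apply/funext => s; rewrite /d !mxE.
  have -> : (A *m x1 t - A *m x2 t) i ord0 = (A *m x1 t) i ord0 - (A *m x2 t) i ord0.
    by rewrite [LHS]mxE [X in _ + X]mxE.
  exact: is_deriveB.
apply/eqP; rewrite -subr_eq0 -/(d 0); apply/eqP/kal => k.
(* The induction covers all nonnegative times, since each differentiation requires vanishing on a
   half-line. *)
suff Cd t : 0 <= t -> (C *m iter k (mulmx A) 1%:M) *m d t = 0.
  have -> : iter k (mulmx A) (d 0) = iter k (mulmx A) 1%:M *m d 0.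
    by elim: k {Cd} => [|k IHk] /=; rewrite ?mul1mx // IHk mulmxA.
  by rewrite mulmxA Cd.
elim: k t => [|k IHk] t t0 /=; first by rewrite mulmx1 /d mulmxBr C12 ?subrr.
have Acomm : A *m iter k (mulmx A) 1%:M = iter k (mulmx A) 1%:M *m A.
  elim: k {IHk} => [|k IHk] /=; first by rewrite mulmx1 mul1mx.
  by rewrite -mulmxA -IHk.
apply/matrixP => i j; rewrite ord1 Acomm mulmxA -mulmxA [RHS]mxE.
apply: is_derive_zero_right (is_derive_output _ _ _ Ad) _ => s ts.
by rewrite (IHk s (le_trans t0 ts)) mxE.
Qed.

(** The vector [u + i w] is an eigenvector for [a + i b]. The real part of
    [exp ((a + i b) t) (u + i w)] is a trajectory that starts at [u] and has the same output as the
    zero trajectory. *)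
Lemma not_observable_real_mode (R : realType) n m (A : 'M[R]_n) (C : 'M[R]_(m, n))
    (u w : 'cV[R]_n) (a b : R) :
  A *m u = a *: u - b *: w -> A *m w = b *: u + a *: w ->
  C *m u = 0 -> C *m w = 0 -> u != 0 -> ~ observable A C.
Proof.
move=> Au Aw Cu Cw u0 obs.
pose x t : 'cV[R]_n := expR (a * t) *: (cos (b * t) *: u - sin (b * t) *: w).
have Ax : solves A x.
  move=> t i; rewrite (_ : (fun s => _) = (expR \o (a \*: id)) *
      (u i 0 \*: (cos \o (b \*: id)) - w i 0 \*: (sin \o (b \*: id)))); last first.
    apply/funext => s; rewrite !mxE /=.
    by congr (_ * (_ - _)); rewrite mulrC.
  have lin (k : R) : is_derive t (1 : R) (k \*: id) k.
    rewrite -[X in is_derive _ _ _ X]mulr1; exact: is_deriveZ.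
  have := is_derive1_comp (is_derive_cos _) (lin b).
  have := is_derive1_comp (is_derive_sin _) (lin b).
  have := is_derive1_comp (is_derive_expR _) (lin a) => De Ds Dc.
  apply: is_derive_eq.
  rewrite -scalemxAr mulmxBr -!scalemxAr Au Aw !mxE !fctE /= /GRing.scale /=.
  ring.
have A0 : solves A (fun=> 0).
  move=> t i; rewrite (_ : (fun s => _) = cst 0); last by apply/funext => s; rewrite mxE.
  have -> : (A *m (0 : 'cV[R]_n)) i ord0 = 0 by rewrite mulmx0 mxE.
  exact: is_derive_cst.
have x0 : x 0 = 0.
  apply: (obs _ _ Ax A0) => t _.
  by rewrite -scalemxAr mulmxBr -!scalemxAr Cu Cw !scaler0 subrr scaler0 mulmx0.
move/eqP: x0; rewrite /x !mulr0 expR0 cos0 sin0 scale0r subr0 !scale1r.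
by rewrite (negPf u0).
Qed.

Lemma not_observable_mode (R : realType) n m (A : 'M[R]_n) (C : 'M[R]_(m, n))
    (v : 'cV[R[i]]_n) (z : R[i]) :
  map_mx (real_complex R) A *m v = z *: v -> map_mx (real_complex R) C *m v = 0 ->
  v != 0 -> ~ observable A C.
Proof.
move=> Av Cv v0.
pose u := map_mx (@complex.Re R) v; pose w := map_mx (@complex.Im R) v.
have reM k (M : 'M[R]_(k, n)) : M *m u = map_mx (@complex.Re R) (map_mx (real_complex R) M *m v).
  apply/matrixP => i j; rewrite !mxE raddf_sum; apply: eq_bigr => l _.
  by rewrite !mxE; case: (v l j) => x y /=; ring.
have imM k (M : 'M[R]_(k, n)) : M *m w = map_mx (@complex.Im R) (map_mx (real_complex R) M *m v).
  apply/matrixP => i j; rewrite !mxE raddf_sum; apply: eq_bigr => l _.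
  by rewrite !mxE; case: (v l j) => x y /=; ring.
have Au : A *m u = complex.Re z *: u - complex.Im z *: w.
  by rewrite reM Av; apply/matrixP => i j; rewrite !mxE; case: (z) (v i j) => [? ?] [? ?] /=.
have Aw : A *m w = complex.Im z *: u + complex.Re z *: w.
  rewrite imM Av; apply/matrixP => i j; rewrite !mxE; case: (z) (v i j) => [? ?] [? ?] /=; ring.
have Cu : C *m u = 0 by rewrite reM Cv; apply/matrixP => i j; rewrite !mxE.
have Cw : C *m w = 0 by rewrite imM Cv; apply/matrixP => i j; rewrite !mxE.
have [u0|] := eqVneq u 0; last exact: not_observable_real_mode Au Aw Cu Cw.
(* When the real part of [v] vanishes, multiplying [v] by [- i] yields the real part [w] and the
   imaginary part [- u]. *)
apply: (@not_observable_real_mode _ _ _ A C w (- u) (complex.Re z) (complex.Im z)) => //.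
- by rewrite scalerN opprK addrC.
- by rewrite mulmxN Au opprB scalerN addrC.
- by rewrite mulmxN Cu oppr0.
apply: contraNneq v0 => w0; apply/eqP/matrixP => i j.
move/matrixP/(_ i j): u0; move/matrixP/(_ i j): w0; rewrite !mxE.
by case: (v i j) => x y /= -> ->.
Qed.

(** * Systems assembled from disjoint paths and cycles *)

Section Cactus.
Variables (F : numFieldType) (n m : nat).
Implicit Types (M : 'I_n + 'I_m -> 'I_n -> nat) (D : {set 'I_n}) (x : 'I_n -> F).
(** A row of [col_mx A C] is [inl j], the derivative of state [j], or [inr y],
    the output [y]. *)
Implicit Types (p q : 'I_n + 'I_m).

(** Natural weights let one pattern be read both as a real realization and over the complex numbers,
    where its eigenvectors are studied. *)
Definition act M x p : F := \sum_i (M p i)%:R * x i.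
Definition state x p : F := if p is inl j then x j else 0.
Definition inside D p : bool := if p is inl j then j \in D else true.
Definition supported D x := forall i, i \notin D -> x i = 0.
Definition restrict D x i : F := if i \in D then x i else 0.

(** The steady response [x exp (z t)] to an input [w exp (z t)] injected at row [q], the outputs
    (with the injected term) being zero. Since [state] is 0 at outputs, one equation serves for both
    kinds of rows. *)
Definition forced_mode M x z q w :=
  forall p, act M x p = z * state x p - w * (p == q)%:R.
Definition mode M x z := forall p, act M x p = z * state x p.

(** The last clause says that an input at [q] of frequency [z], [|z| > B], cannot
    leave the output identically zero.  It is what allows a cycle all of whose
    eigenvalues have modulus larger than [B] to be attached at [q]. *)
Definition good D M (B : nat) :=
  [/\ forall p i, M p i != 0%N -> (i \in D) && inside D p,
      forall z x, supported D x -> mode M x z -> forall i, x i = 0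
    & forall z x q w, B%:R < `|z| -> supported D x -> inside D q ->
        forced_mode M x z q w -> w = 0].

Lemma actD M N x p : act (fun p i => M p i + N p i)%N x p = act M x p + act N x p.
Proof.
by rewrite -big_split /=; apply: eq_bigr => i _; rewrite natrD mulrDl.
Qed.

Lemma act_restrict D M x p : (forall p i, M p i != 0%N -> i \in D) ->
  act M x p = act M (restrict D x) p.
Proof.
move=> MD; apply: eq_bigr => i _; rewrite /restrict.
by case: ifP => // /negbT iD; rewrite (contraNeq (MD p i) iD) !mul0r.
Qed.

Lemma restrict_supported D x : supported D (restrict D x).
Proof. by move=> i /negbTE iD; rewrite /restrict iD. Qed.

Lemma restrict_id D x : supported D x -> restrict D x =1 x.
Proof. by move=> xD i; rewrite /restrict; case: ifP => // /negbT/xD. Qed.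

Lemma eq_act M x y p : x =1 y -> act M x p = act M y p.
Proof. by move=> xy; apply: eq_bigr => i _; rewrite xy. Qed.

Variable f : 'I_n -> 'I_n + 'I_m.
Hypothesis f_inj : injective f.

Definition matching_on D p i : nat := (i \in D) && (f i == p).

Lemma act_matching D x i : i \in D -> act (matching_on D) x (f i) = x i.
Proof.
move=> iD; rewrite /act (bigD1 i) //= /matching_on iD eqxx mul1r big1 ?addr0 // => j ji.
by rewrite (inj_eq f_inj) (negPf ji) andbF mul0r.
Qed.

Lemma good0 : good set0 (matching_on set0) 0.
Proof.
split=> [p i|z x x0 _ i|z x q w _ x0 qin mx]; rewrite /matching_on ?inE //.
  by apply: x0; rewrite inE.
have q0 : state x q = 0 by case: q qin {mx} => //= j; rewrite inE.
move: (mx q); rewrite q0 mulr0 sub0r eqxx mulr1 /act big1 => [/esym/eqP|i _].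
  by rewrite oppr_eq0 => /eqP.
by rewrite x0 ?mulr0 ?inE.
Qed.

(** The new vertex [v] has no incoming edge and feeds only [f v]. Unforced, it must carry 0; an
    input at [v] is relayed to [f v], divided by [z], where the clause for [D] applies. *)
Lemma good_add_leaf D v : good D (matching_on D) 0 -> v \notin D -> inside D (f v) ->
  good (v |: D) (matching_on (v |: D)) 0.
Proof.
move=> [supM g1 g2] vD vin.
have fD i : i \in D -> inside D (f i).
  by move=> iD; have /andP[] // : (i \in D) && inside D (f i) by apply: supM;
    rewrite /matching_on iD eqxx.
have fin i : i \in v |: D -> inside D (f i) by case/setU1P => [->|/fD].
have insideS p : inside D p -> inside (v |: D) p by case: p => //= j jD; rewrite !inE jD orbT.
have vrow x : act (matching_on (v |: D)) x (inl v) = 0.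
  rewrite /act big1 // => i _; rewrite /matching_on; case: andP => [[/fin fi /eqP fiv]|];
    last by rewrite mul0r.
  by move: fi; rewrite fiv /= (negPf vD).
have step x p : act (matching_on (v |: D)) x p
  = act (matching_on D) (restrict D x) p + x v * (p == f v)%:R.
  rewrite -act_restrict; last by move=> q i; rewrite /matching_on; case: (i \in D).
  rewrite /act (bigD1 v) //= [in RHS](bigD1 v) //= /matching_on (negPf vD) setU11 /= mul0r add0r.
  rewrite addrC eq_sym mulrC; congr (_ + _); apply: eq_bigr => i iv.
  by rewrite in_setU1 (negPf iv).
have restr x : supported (v |: D) x -> x v = 0 -> restrict D x =1 x.
  move=> xD xv i; rewrite /restrict; case: ifP => // /negbT iD.
  by have [->//|iv] := eqVneq i v; rewrite xD // !inE negb_or iv.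
split=> [p i|z x xD mx i|z x q w z0 xD qin mx].
- by rewrite {1}/matching_on; case: andP => // -[iD /eqP <- _]; rewrite iD insideS ?fin.
- have xv : x v = 0.
    (* At eigenvalue 0 the row of [v] is uninformative, but row [f v] has [v] as its only entry. *)
    have [z0|z0] := eqVneq z 0;
      first by rewrite -(@act_matching (v |: D) x v) ?setU11 // mx z0 mul0r.
    by apply: (mulfI z0); rewrite mulr0 -(mx (inl v)) vrow.
  apply: (g1 z x) => [j jD|p].
    by have [->//|jv] := eqVneq j v; rewrite xD // !inE negb_or jv.
  by rewrite -mx step xv mul0r addr0; apply: eq_act => j; rewrite restr.
have [qv|qv] := eqVneq q (inl v).
  have zx : z * x v = w.
    by move: (mx q); rewrite qv vrow eqxx mulr1 => /esym/eqP; rewrite subr_eq0 => /eqP.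
  suff xv : x v = 0 by rewrite -zx xv mulr0.
  apply: (g2 z (restrict D x) (f v) (x v)) => // [|p]; first exact: restrict_supported.
  apply: (addIr (x v * (p == f v)%:R)); rewrite -step mx subrK qv.
  have [->|pv] := eqVneq p (inl v).
    by rewrite mulr1 /= zx subrr /restrict (negPf vD) mulr0.
  rewrite mulr0 subr0; case: p pv => //= j jv; rewrite /restrict; case: ifP => // /negbT jD.
  by rewrite xD // !inE negb_or jD andbT; apply: contraNneq jv => ->.
have xv : x v = 0.
  have /eqP : z * x v = 0 by have := mx (inl v); rewrite vrow /= eq_sym (negPf qv) mulr0 subr0.
  by rewrite mulf_eq0 -normr_eq0 gt_eqF //= => /eqP.
apply: (g2 z x q w) => // [j jD||p].
- by have [->//|jv] := eqVneq j v; rewrite xD // !inE negb_or jv.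
- by case: q qin qv {mx} => //= j; rewrite !inE => /predU1P[->|]; rewrite ?eqxx.
by rewrite -mx step xv mul0r addr0; apply: eq_act => j; rewrite restr.
Qed.


(** [K] is the [f]-cycle of [v], with weight [B.+1] on each edge, and the edge from
    [v] to [u] has weight 1.  On an eigenvector that does not vanish on [K], taking
    norms and summing over [K] gives [|z| = B.+1]; no vertex of [K] then carries 0,
    so that [v] excites [u] and the clause on forced modes applies below. *)
Lemma good_add_cycle D M B v u : good D M B -> v \notin D -> inside D u ->
    (forall i, i \notin D -> exists2 j, j \notin D & f i = inl j) ->
  exists (K : {set 'I_n}) (N : 'I_n + 'I_m -> 'I_n -> nat),
    [/\ v \in K, good (D :|: K) (fun p i => M p i + N p i)%N B.+1,
      forall i, i \notin D :|: K -> exists2 j, j \notin D :|: K & f i = inl j &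
      forall p i, N p i != 0%N -> p = f i \/ (p = u /\ i = v)].
Proof.
move=> [supM g1 g2] vD uin fout.
(* Outside [D] this is [f] read as a map on states; the identity on [D] makes it injective
   everywhere, so that its orbits are cycles. *)
pose g i := if i \in D then i else if f i is inl j then j else i.
have fg i : i \notin D -> f i = inl (g i).
  by move=> iD; rewrite /g (negPf iD); have [j _ ->] := fout i iD.
have gD i : (g i \in D) = (i \in D).
  have [iD|iD] := boolP (i \in D); first by rewrite /g iD.
  by have [j jD] := fout i iD; rewrite (fg i iD) => -[->]; apply/negbTE.
have g_inj : injective g.
  move=> i j gij; have [iD|iD] := boolP (i \in D).
    by have := gD j; rewrite -gij gD iD => /esym jD; move: gij; rewrite /g iD jD.
  have jD : j \notin D by rewrite -gD -gij gD.
  by apply: f_inj; rewrite !fg // gij.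
pose K := [set i | fconnect g v i].
have gK i : (g i \in K) = (i \in K) by rewrite !inE -same_fconnect1_r.
have DK i : i \in K -> i \notin D.
  rewrite inE => /iter_findex <-; elim: (findex _ _ _) => //= k; by rewrite gD.
have vK : v \in K by rewrite inE.
have fK i : i \in K -> f i = inl (g i) by move/DK/fg.
have gDK i : i \in K -> (g i \in D) = false by move/DK/negbTE; rewrite gD.
have Kv j i : i \in K -> j \in K -> exists k, i = iter k g j.
  rewrite !inE (fconnect_sym g_inj) => vi vj.
  by exists (findex g j i); rewrite iter_findex // (fconnect_sym g_inj) (connect_trans vi).
clearbody K; clearbody g.
pose s := B.+1.
pose N p i : nat := ((i \in K) * (s * (p == f i) + (i == v) * (p == u)))%N.
have ufK i : i \in K -> (f i == u) = false.
  move=> iK; apply: contraTF uin => /eqP <-.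
  by rewrite fK //= gDK.
have MK i : i \in K -> forall x, act M x (f i) = 0.
  move=> iK x; rewrite /act big1 // => j _; have [->|/supM/andP[_]] := eqVneq (M (f i) j) 0%N;
    first by rewrite mul0r.
  by rewrite fK //= gDK.
have rowK x i : i \in K -> act (fun p i => M p i + N p i)%N x (f i) = s%:R * x i.
  move=> iK; rewrite actD MK // add0r /act (bigD1 i) //= big1 ?addr0 => [|j ji].
    by rewrite /N iK eqxx ufK // !muln0 addn0 mul1n muln1.
  by rewrite /N ufK // (inj_eq f_inj) [i == j]eq_sym (negPf ji) !muln0 mul0r.
have rowD x p : (forall i, i \in K -> p != f i) ->
    act (fun p i => M p i + N p i)%N x p = act M (restrict D x) p + x v * (p == u)%:R.
  move=> pK; rewrite actD; congr (_ + _).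
    by apply: act_restrict => q i /supM/andP[].
  rewrite /act (bigD1 v) //= big1 ?addr0 => [|j jv]; rewrite /N.
    by rewrite vK (negPf (pK v vK)) eqxx muln0 !mul1n add0n mulrC.
  have [jK|jK] := boolP (j \in K); last by rewrite mul0n mul0r.
  by rewrite (negPf (pK j jK)) (negPf jv) muln0 mul0r.
have predK j : j \in K -> exists2 i, i \in K & inl j = f i.
  have [h gh hg] := injF_bij g_inj.
  move=> jK; have hK : h j \in K by rewrite -gK hg.
  by exists (h j) => //; rewrite fK // hg.
(* Seen from [D], the cycle is merely an input of amplitude [x v] at [u]; the original input remains
   only if [q] is inside [D]. *)
have restD x z q w : supported (D :|: K) x ->
    forced_mode (fun p i => M p i + N p i)%N x z q w ->
    forall p, act M (restrict D x) p =
      z * state (restrict D x) p - x v * (p == u)%:R - w * ((p == q) && inside D p)%:R.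
  move=> xDK mx p.
  have key : (forall i, i \in K -> p != f i) ->
      act M (restrict D x) p = z * state x p - x v * (p == u)%:R - w * (p == q)%:R.
    by move=> pK; rewrite addrAC -mx rowD // addrK.
  case: p key => [j|y] key; last by rewrite key ?andbT // => i iK; rewrite fK.
  have [jK|jK] := boolP (j \in K).
    have [i iK fi] := predK j jK.
    rewrite fi MK // ufK // -fi /= (negPf (DK j jK)) andbF !mulr0 !subr0.
    by rewrite /restrict (negPf (DK j jK)) mulr0.
  have pf i : i \in K -> inl j != f i.
    by move=> iK; rewrite fK //; apply: contraNneq jK => -[->]; rewrite gK.
  have [jD|jD] := boolP (j \in D).
    by rewrite key //= jD andbT /restrict jD.
  have uj : (inl j == u) = false by apply: contraTF uin => /eqP <-.
  rewrite uj /= (negPf jD) andbF !mulr0 !subr0 [restrict D x j]/restrict (negPf jD) mulr0 /act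
    big1 //.
  move=> i _; have [->|/supM/andP[_]] := eqVneq (M (inl j) i) 0%N; first by rewrite mul0r.
  by rewrite /= (negPf jD).
have sumK x : \sum_(i in K) `|x (g i)| = \sum_(i in K) `|x i|.
  rewrite [RHS](reindex_inj g_inj) /=; apply: eq_bigl => i; by rewrite gK.
have cycleK z x : (forall i, i \in K -> s%:R * x i = z * x (g i)) ->
    `|z| = s%:R \/ (forall i, i \in K -> x i = 0).
  move=> zx; have : s%:R * \sum_(i in K) `|x i| = `|z| * \sum_(i in K) `|x i|.
    rewrite -[in RHS]sumK !mulr_sumr; apply: eq_bigr => i iK.
    by rewrite -normrM -zx // normrM normr_nat.
  move/eqP; rewrite -subr_eq0 -mulrBl mulf_eq0 subr_eq0 => /orP[/eqP->|]; first by left.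
  rewrite psumr_eq0 // => /allP x0; right=> i iK.
  by have := x0 i; rewrite mem_index_enum iK => /(_ isT); rewrite normr_eq0 => /eqP.
have sB : B%:R < s%:R :> F by rewrite ltr_nat.
have zeroK z x : z != 0 -> (forall i, i \in K -> s%:R * x i = z * x (g i)) ->
    x v = 0 -> forall i, i \in K -> x i = 0.
  move=> z0 zx xv i iK; have [k ->] := Kv v i iK vK.
  elim: k => //= k IHk; apply: (mulfI z0); rewrite -zx ?IHk ?mulr0 //.
  by elim: k {IHk} => //= k; rewrite gK.
have rowKm x z q w : forced_mode (fun p i => M p i + N p i)%N x z q w -> forall i, i \in K ->
   s%:R * x i = z * x (g i) - w * (f i == q)%:R.
  by move=> mx i iK; rewrite -rowK // mx {1}fg // DK.
have restr x : supported (D :|: K) x -> (forall i, i \in K -> x i = 0) -> supported D x.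
  move=> xDK xK i iD; have [/xK//|iK] := boolP (i \in K).
  by rewrite xDK // inE negb_or iD.
have NP p i : N p i != 0%N -> i \in K /\ (p = f i \/ (p = u /\ i = v)).
  rewrite /N; case: (i \in K) => //; have [->|_] := eqVneq p (f i); first by auto.
  by have [->|_] := eqVneq i v; have [->|_] := eqVneq p u; rewrite ?muln0 //; auto.
exists K, N; split=> // [|i|p i]; last 2 first.
- by rewrite inE negb_or => /andP[iD iK]; exists (g i); rewrite ?fg // inE negb_or gD gK iD.
- by case/NP.
split=> [p i|z x xDK mx i|z x q w zs xDK qin mx].
- rewrite addn_eq0 negb_and => /orP[/supM/andP[iD pin]|/NP[iK Np]].
    by rewrite !inE iD /=; case: p pin => //= j; rewrite inE => ->.
  rewrite inE iK orbT /=; case: Np => [->|[-> _]].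
    by rewrite fK //= inE gK iK orbT.
  by case: (u) uin => //= j; rewrite inE => ->.
- have mx0 : forced_mode (fun p i => M p i + N p i)%N x z u 0 by move=> p; rewrite mul0r subr0.
  have zx j : j \in K -> s%:R * x j = z * x (g j) by move/(rowKm _ _ _ _ mx0); rewrite mul0r subr0.
  have rx p := restD _ _ _ _ xDK mx0 p.
  have xK : forall j, j \in K -> x j = 0.
    have [zs|//] := cycleK _ _ zx.
    apply: (zeroK z) => //; first by rewrite -normr_eq0 zs pnatr_eq0.
    apply: (g2 z (restrict D x) u) => // [||p]; rewrite ?zs //; first exact: restrict_supported.
    by rewrite rx mul0r subr0.
  have xD := restr _ xDK xK.
  apply: (g1 z x) => // p.
  have := rx p; rewrite (eq_act _ _ (restrict_id xD)) => ->.
  rewrite xK // !mul0r !subr0; congr (_ * _).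
  by case: p => //= j; rewrite restrict_id.
have z0 : z != 0 by rewrite -normr_eq0 gt_eqF // (le_lt_trans _ zs).
have zB : B%:R < `|z| := lt_trans sB zs.
have rx p := restD _ _ _ _ xDK mx p.
have [qD|qD] := boolP (inside D q).
  have zx j : j \in K -> s%:R * x j = z * x (g j).
    move=> jK; rewrite (rowKm _ _ _ _ mx) // [f j == q](_ : _ = false) ?mulr0 ?subr0 //.
    by apply: contraTF qD => /eqP <-; rewrite fK //= DK // gK.
  have xK : forall j, j \in K -> x j = 0.
    have [zs'|//] := cycleK _ _ zx.
    by rewrite zs' ltxx in zs.
  apply: (g2 z (restrict D x) q) => // [|p]; first exact: restrict_supported.
  rewrite rx xK // mul0r subr0; congr (_ - _ * _%:R).
  by have [->|] := eqVneq p q; rewrite ?qD.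
(* The input now sits at a state [j0] of the cycle. The clause for [D] gives [x v = 0], which forces
   zeros around the whole cycle; the row of the predecessor of [j0] then reads [w = 0]. *)
case: q => [j0|//] in qin qD mx rx *.
rewrite /= in qD; have j0K : j0 \in K by move: qin; rewrite /= inE (negPf qD).
have xv : x v = 0.
  apply: (g2 z (restrict D x) u) => // [|p]; first exact: restrict_supported.
  rewrite rx -[RHS]subr0; congr (_ - _); have [->|] := eqVneq p (inl j0).
    by rewrite /= (negPf qD) mulr0.
  by rewrite mulr0.
have zx j : j \in K -> g j != j0 -> s%:R * x j = z * x (g j).
  move=> jK gj; rewrite (rowKm _ _ _ _ mx) // fg ?DK //.
  by rewrite -[inl _ == inl _]/(g j == j0) (negPf gj) mulr0 subr0.
have iterK k j : j \in K -> iter k g j \in K by move=> jK; elim: k => //= k; rewrite gK.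
have xj0 : x j0 = 0.
  apply/eqP; apply: contraTT isT => xj0; have [k vk] := Kv j0 v vK j0K.
  suff : x (iter k g j0) != 0 by rewrite -vk xv eqxx.
  elim: k {vk} => //= k IHk.
  have [->//|gj] := eqVneq (g (iter k g j0)) j0.
  apply: contraNneq IHk => xg; move: (zx _ (iterK k _ j0K) gj); rewrite xg mulr0 => /eqP.
  by rewrite mulf_eq0 pnatr_eq0.
have xK k : x (iter k g j0) = 0.
  elim: k => //= k IHk; have [->//|gj] := eqVneq (g (iter k g j0)) j0.
  by apply: (mulfI z0); rewrite -zx ?iterK // IHk !mulr0.
have [i iK fi] := predK j0 j0K.
have [k ik] := Kv j0 i iK j0K.
have := rowKm _ _ _ _ mx i iK; rewrite -fi eqxx mulr1 ik xK mulr0.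
have -> : g (iter k g j0) = j0 by rewrite -ik; move: fi; rewrite fK // => -[].
by rewrite xj0 mulr0 sub0r => /esym/eqP; rewrite oppr_eq0 => /eqP.
Qed.

Variable edge : 'I_n + 'I_m -> 'I_n -> bool.
Hypothesis f_edge : forall i, edge (f i) i.
Hypothesis exit : forall D, D != setT ->
  exists v u, [/\ v \notin D, edge u v & inside D u].

Lemma observable_pattern : exists M : 'I_n + 'I_m -> 'I_n -> nat,
  (forall p i, M p i != 0%N -> edge p i) /\
  (forall z x, mode M x z -> forall i, x i = 0).
Proof.
(* [D] collects the paths of [f] that end in outputs, from the output end backwards; once nothing
   can be added, [f] maps the remaining states among themselves. *)
have [D gD outD] : exists2 D, good D (matching_on D) 0 &
    forall i, i \notin D -> exists2 j, j \notin D & f i = inl j.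
  suff leaves k D : (#|~: D| <= k)%N -> good D (matching_on D) 0 ->
      exists2 D, good D (matching_on D) 0 &
        forall i, i \notin D -> exists2 j, j \notin D & f i = inl j.
    exact: leaves (leqnn _) good0.
  elim: k D => [|k IHk] D Dk gD.
    exists D => // i; move: Dk; rewrite leqn0 cards_eq0 => /eqP/setP/(_ i).
    by rewrite !inE => ->.
  have [/existsP[v /andP[vD vin]]|/existsPn noleaf] := boolP [exists v, (v \notin D) && inside
    D (f v)].
    apply: (IHk (v |: D)); last exact: good_add_leaf.
    by rewrite setCU setIC -setDE -ltnS (leq_trans _ Dk) // [in X in (_ < X)%N](cardsD1 v) inE vD.
  exists D => // i iD; have := noleaf i; rewrite iD; case: (f i) => //= j jD; by exists j.
(* The remaining states form cycles, attached one at a time through an edge supplied by [exit]; the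
   bound grows by one each time. *)
have [M [B [gM Medge]]] : exists M B, good [set: 'I_n] M B /\ forall p i, M p i != 0%N -> edge p i.
  suff cycles k E M B : (#|~: E| <= k)%N -> good E M B ->
      (forall i, i \notin E -> exists2 j, j \notin E & f i = inl j) ->
      (forall p i, M p i != 0%N -> edge p i) ->
      exists M B, good [set: 'I_n] M B /\ forall p i, M p i != 0%N -> edge p i.
    apply: (cycles _ _ _ _ (leqnn _) gD outD) => p i.
    by rewrite /matching_on; case: andP => // -[_ /eqP <-].
  elim: k E M B => [|k IHk] {gD outD}D M B Dk gM outD Medge.
    suff <- : D = setT by exists M, B.
    by apply: setC_inj; apply/eqP; rewrite setCT -cards_eq0 -leqn0.
  have [DT|/exit[v [u [vD uv uD]]]] := eqVneq D setT; first by exists M, B; rewrite -DT.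
  have [K [N [vK gN outK NE]]] := good_add_cycle gM vD uD outD.
  apply: (IHk _ _ _ _ gN outK) => [|p i].
    rewrite -ltnS (leq_trans _ Dk) // proper_card // properEneq setCS subsetUl andbT.
    by apply: contraNneq vD => /setP/(_ v); rewrite !inE vK orbT /= => /esym/negbFE.
  by rewrite addn_eq0 negb_and => /orP[/Medge//|/NE[->//|[-> ->]//]].
exists M; split=> // z x mx; case: gM => _ g1 _; apply: (g1 z) => // i.
by rewrite inE.
Qed.

End Cactus.

(** * Structural observability *)

Lemma connect_stable (T : finType) (e : rel T) (P : T -> Prop) x y :
  (forall a b, P a -> e a b -> P b) -> P x -> connect e x y -> P y.
Proof.
move=> eP Px /connectP[p + ->]; elim: p x Px => //= a p IHp x Px /andP[xa]; apply: IHp.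
exact: eP xa.
Qed.

Lemma rank_le_grank (R : realType) m p (M : 'M[bool]_(m, p)) (X : 'M[R]_(m, p)) :
  parameter_values M X -> (\rank X <= grank R M)%N.
Proof.
move=> MX; have rX : (\rank X < (minn m p).+1)%N by rewrite ltnS leq_min rank_leq_row rank_leq_col.
rewrite /grank -[\rank X]/(nat_of_ord (Ordinal rX)).
by apply: (@leq_bigmax_cond _ _ (@nat_of_ord _)); apply/asboolP; exists X.
Qed.

Lemma grank_attained (R : realType) m p (M : 'M[bool]_(m, p)) :
  exists2 X : 'M[R]_(m, p), parameter_values M X & \rank X = grank R M.
Proof.
pose P (k : 'I_(minn m p).+1) :=
  `[< exists X : 'M[R]_(m, p), parameter_values M X /\ \rank X = k >].
rewrite (_ : grank R M = \max_(k in [pred k | P k]) k) //.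
have P0 : (0 < #|[pred k | P k]|)%N.
  apply/card_gt0P; exists ord0; rewrite inE; apply/asboolP; exists 0.
  by split=> [i j _|]; rewrite ?mxE ?mxrank0.
by have [k /asboolP[X [MX rX]] ->] := eq_bigmax_cond (@nat_of_ord _) P0; exists X.
Qed.

Lemma grank_le_col (R : realType) m p (M : 'M[bool]_(m, p)) : (grank R M <= p)%N.
Proof. by have [X _ <-] := grank_attained R M; exact: rank_leq_col. Qed.

Lemma rank_deficient_kernel (F : fieldType) m n (M : 'M[F]_(m, n)) :
  (\rank M < n)%N -> exists2 v : 'cV_n, v != 0 & M *m v = 0.
Proof.
move=> rM; have : kermx M^T != 0.
  by rewrite -mxrank_eq0 mxrank_ker mxrank_tr -lt0n subn_gt0.
case/rowV0Pn => u /sub_kermxP uM u0; exists u^T; rewrite ?trmx_eq0 //.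
by apply: trmx_inj; rewrite trmx_mul trmxK uM trmx0.
Qed.

Lemma rank_full_kernel (F : fieldType) m n (M : 'M[F]_(m, n)) :
  (forall v : 'cV_n, M *m v = 0 -> v = 0) -> \rank M = n.
Proof.
move=> M0; apply/eqP; rewrite eqn_leq rank_leq_col leqNgt; apply/negP.
by case/rank_deficient_kernel => v v0 /M0 v_eq0; rewrite v_eq0 eqxx in v0.
Qed.

Lemma kernel_full_rank (F : fieldType) m n (M : 'M[F]_(m, n)) (v : 'cV_n) :
  \rank M = n -> M *m v = 0 -> v = 0.
Proof.
move=> rM Mv; apply: trmx_inj; rewrite trmx0; apply/eqP; rewrite -submx0.
suff <- : kermx M^T = 0 by apply/sub_kermxP; rewrite -trmx_mul Mv trmx0.
by apply/eqP; rewrite -mxrank_eq0 mxrank_ker mxrank_tr rM subnn.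
Qed.

Definition senses n m (A : 'M[bool]_n) (C : 'M[bool]_(m, n)) (x : 'I_n) : Prop :=
  exists z y, connect (state_digraph A) x z /\ C y z.

(** Vectors supported on the states reachable from [x] form an invariant space. If none of these
    states is measured, an eigenvector in this space is invisible to the outputs. *)
Lemma struct_observable_senses (R : realType) n m (A : 'M[bool]_n) (C : 'M[bool]_(m, n)) x :
  struct_observable R A C -> senses A C x.
Proof.
move=> [A0 [C0 [sA sC obs]]]; apply: contrapT => nx.
pose P (v : 'cV[R[i]]_n) := forall j, ~~ connect (state_digraph A) x j -> v j 0 = 0.
have [v [z [Pv v0 Av]]] : exists v z, [/\ P v, v != 0 & map_mx (real_complex R) A0 *m v = z *: v].
  apply: (@invariant_eigenvector _ _ _ P (delta_mx x 0)) => [v z Pv j xj|j xj|].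
  - rewrite !mxE Pv // mulr0 subr0 big1 // => i _.
    have [xi|/Pv->] := boolP (connect (state_digraph A) x i); last by rewrite mulr0.
    suff /eqP Aji : A0 j i == 0 by rewrite mxE Aji rmorph0 mul0r.
    rewrite -[_ == 0]negbK -sA; apply: contra xj => Aji.
    exact: connect_trans xi (connect1 _).
  - by rewrite mxE; case: eqP xj => // ->; rewrite connect0.
  by apply/eqP => /matrixP/(_ x 0)/eqP; rewrite !mxE !eqxx oner_eq0.
apply: not_observable_mode Av _ v0 obs.
apply/matrixP => y j; rewrite ord1 !mxE big1 // => i _.
have [xi|/Pv->] := boolP (connect (state_digraph A) x i); last by rewrite mulr0.
suff /eqP Cyi : C0 y i == 0 by rewrite mxE Cyi rmorph0 mul0r.
by rewrite -[_ == 0]negbK -sC; apply/negP => Cyi; apply: nx; exists i, y.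
Qed.

(** A nonzero common kernel vector of [A0] and [C0] is an equilibrium with zero output. *)
Lemma struct_observable_grank (R : realType) n m (A : 'M[bool]_n) (C : 'M[bool]_(m, n)) :
  struct_observable R A C -> grank R (col_mx A C) = n.
Proof.
move=> [A0 [C0 [sA sC obs]]]; apply/eqP; rewrite eqn_leq grank_le_col leqNgt; apply/negP => gn.
have sAC : parameter_values (col_mx A C) (col_mx A0 C0).
  by move=> i j; rewrite !mxE; case: splitP => k _; rewrite ?sA ?sC negbK => /eqP.
have [v v0] := rank_deficient_kernel (leq_ltn_trans (rank_le_grank sAC) gn).
rewrite mul_col_mx => Mv.
have [Av Cv] : A0 *m v = 0 /\ C0 *m v = 0.
  by apply: eq_col_mx; rewrite Mv col_mx0.
by apply: (@not_observable_real_mode R n m A0 C0 v 0 0 0) obs;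
  rewrite ?mulmx0 ?scale0r ?subrr ?addr0.
Qed.

(** A nonzero maximal minor has a nonzero term in its Leibniz expansion, and the permutation of that
    term is the matching. *)
Lemma full_grank_matching (R : realType) m n (M : 'M[bool]_(m, n)) :
  grank R M = n -> exists2 f : 'I_n -> 'I_m, injective f & forall i, M (f i) i.
Proof.
have [X MX <-] := grank_attained R M => /eqP rX.
have fX : row_full X by [].
have := fullrowsub_unit fX; rewrite unitmxE unitfE => /eqP d0.
have [s s0] : exists s : 'S_n, forall i, X (fullrankfun fX i) (s i) != 0.
  apply: contrapT => ns; apply: d0; rewrite /determinant big1 // => s _.
  have [/forallP sX|/forallPn[i /negPn/eqP si]] := boolP [forall i, X (fullrankfun fX i) (s i)
    != 0].
    by case: ns; exists s.
  by rewrite (bigD1 i) //= mxE si mul0r mulr0.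
exists (fun j => fullrankfun fX ((s^-1)%g j)) => [i j /fullrankfun_inj/perm_inj//|i].
by have := s0 ((s^-1)%g i); rewrite permKV; apply: contraNT => /MX ->.
Qed.

(** [X] may vanish at free parameters. The segment to the 0-1 matrix of the pattern keeps the fixed
    zeros, and all but finitely many of its points have full Kalman rank and nonzero free
    entries. *)
Lemma observable_completion (R : realType) n m (A : 'M[bool]_n) (C : 'M[bool]_(m, n))
    (X : 'M[R]_(n + m, n)) :
  parameter_values (col_mx A C) X -> \rank (kalman (usubmx X) (dsubmx X)) = n ->
  struct_observable R A C.
Proof.
move=> + rX; have [M ME] : exists M, M = col_mx A C by exists (col_mx A C).
rewrite -ME => MX.
pose I := interpol X (\matrix_(i, j) (M i j)%:R).
pose K := kalman (usubmx I) (dsubmx I).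
have [p p0 rK] := rank_le_specialization K 0.
pose q := \prod_i \prod_(j | M i j) I i j.
have [t] : exists t, (p * q).[t] != 0.
  apply: exists_nonroot; rewrite mulf_neq0 //; first by apply: contraNneq p0 => ->; rewrite horner0.
  apply/prodf_neq0 => i _; apply/prodf_neq0 => j Mij.
  apply/eqP => Iij; have /matrixP/(_ i j) := interpol1 X (\matrix_(i, j) (M i j)%:R).
  by rewrite [LHS]mxE -/I Iij mxE Mij /horner_eval horner0 => /esym/eqP; rewrite oner_eq0.
rewrite hornerM mulf_eq0 negb_or => /andP[pt qt].
pose Y := map_mx (horner_eval t) I.
have MY i j : M i j = (Y i j != 0).
  have [Mij|Mij] := boolP (M i j).
    apply/esym; apply: contraNneq qt => Yij; rewrite /q (bigD1 i) //= (bigD1 j) //= !hornerM.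
    by move: Yij; rewrite mxE /horner_eval => ->; rewrite !mul0r.
  rewrite /Y interpolE; apply/esym/eqP.
  by rewrite !mxE MX ?(negPf Mij) // subr0 mulr0n mulr0 addr0.
exists (usubmx Y), (dsubmx Y); split.
- by move=> i j; rewrite mxE -MY ME col_mxEu.
- by move=> i j; rewrite mxE -MY ME col_mxEd.
apply: observable_kalman => v /kalman_eq0; apply: kernel_full_rank.
apply/eqP; rewrite eqn_leq rank_leq_col -[X in (X <= _)%N]rX.
have := rK t pt; rewrite /K !map_kalman !map_usubmx !map_dsubmx.
by rewrite [map_mx _ I in X in (X <= _)%N]interpol0.
Qed.

Lemma struct_observableP (R : realType) n m (A : 'M[bool]_n) (C : 'M[bool]_(m, n)) :
  struct_observable R A C <-> (forall x, senses A C x) /\ grank R (col_mx A C) = n.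
Proof.
split=> [obs|[reach gn]].
  by split; [move=> x; exact: struct_observable_senses obs|exact: struct_observable_grank].
have [f f_inj fM] := full_grank_matching gn.
pose edge (p : 'I_n + 'I_m) i := col_mx A C (unsplit p) i.
(* On a path from a state outside [E] to a measured state, either some edge enters [E], or the last
   state is outside [E] and feeds an output. *)
have exit (E : {set 'I_n}) : E != setT -> exists v p, [/\ v \notin E, edge p v & inside E p].
  move=> ET; apply: contrapT => nexit.
  have [v0 v0E] : exists v0, v0 \notin E.
    by apply: contrapT => H; case/eqP: ET; apply/setP => i; rewrite inE;
      apply: contrapT => /negP iE; case: H; exists i.
  have [z [y [v0z Cyz]]] := reach v0.
  have zE : z \notin E.
    apply: (connect_stable (P := fun a => a \notin E) _ v0E v0z) => a b aE ab.
    by apply/negP => bE; apply: nexit; exists a, (inl b); rewrite /edge /= col_mxEu.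
  by apply: nexit; exists z, (inr y); rewrite /edge /= col_mxEd.
have sf_inj : injective (fun i => fintype.split (f i)) by move=> i j /(can_inj splitK)/f_inj.
have sfM i : edge (fintype.split (f i)) i by rewrite /edge splitK.
have [M [ME Mobs]] := @observable_pattern R[i] n m _ sf_inj _ sfM exit.
pose X : 'M[R]_(n + m, n) := \matrix_(i, j) (M (fintype.split i) j)%:R.
apply: (@observable_completion _ _ _ _ _ X).
  by move=> i j; rewrite [X i j]mxE; have [->//|/ME] := eqVneq (M (fintype.split i) j) 0%N;
    rewrite /edge splitK => ->.
apply: rank_full_kernel => v /kalman_eq0 Xv.
set A1 := usubmx X in Xv; set C1 := dsubmx X in Xv.
pose Ac := map_mx (real_complex R) A1; pose Cc := map_mx (real_complex R) C1.
apply/eqP; apply: contraT => v0.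
(* Initial states with identically zero output form an invariant space; a nonzero one yields an
   eigenvector, which is a mode of the pattern [M]. *)
pose P (x : 'cV[R[i]]_n) := forall k, Cc *m iter k (mulmx Ac) x = 0.
have [x [z [Px x0 Ax]]] : exists x z, [/\ P x, x != 0 & Ac *m x = z *: x].
  apply: (@invariant_eigenvector _ _ _ P (map_mx (real_complex R) v)) => [x z Px k|k|].
  - have -> : iter k (mulmx Ac) (Ac *m x - z *: x)
    = iter k.+1 (mulmx Ac) x - z *: iter k (mulmx Ac) x.
      by elim: k => //= k ->; rewrite mulmxBr -scalemxAr.
    by rewrite mulmxBr -scalemxAr !Px scaler0 subr0.
  - have -> : iter k (mulmx Ac) (map_mx (real_complex R) v)
    = map_mx (real_complex R) (iter k (mulmx A1) v).
      by elim: k => //= k ->; rewrite map_mxM.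
    by rewrite -map_mxM Xv map_mx0.
  by rewrite map_mx_eq0.
case/eqP: x0; apply/matrixP => i j; rewrite ord1 mxE.
apply: (Mobs z (fun i => x i 0)) => -[k|y] /=.
  have /matrixP/(_ k 0) := Ax; rewrite !mxE => <-; apply: eq_bigr => l _.
  by rewrite !mxE -[lshift _ _]/(unsplit (inl k)) unsplitK rmorph_nat.
have /matrixP/(_ y 0) := Px 0; rewrite mulr0 !mxE => <-; apply: eq_bigr => l _.
by rewrite !mxE -[rshift _ _]/(unsplit (inr y)) unsplitK rmorph_nat.
Qed.

(** * Generic ranks as a matroid rank function *)

Section Selection.
Variables (n r : nat).
Implicit Types J T : {set 'I_r}.

Definition stack_index J (i : 'I_(n + #|J|)) : 'I_(n + r) :=
  match fintype.split i with inl a => lshift r a | inr b => rshift n (enum_val b) end.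

(** All matrices [colAC A C J] become row selections of one matrix, so that a single realization can
    serve every sensor set at once. *)
Definition stack (K : Type) (p : nat) J (X : 'M[K]_(n + r, p)) : 'M[K]_(n + #|J|, p) :=
  rowsub (@stack_index J) X.

Lemma stack_index_inj J : injective (@stack_index J).
Proof.
move=> k l; rewrite /stack_index -{2}[k]splitK -{2}[l]splitK.
case: (fintype.split k) (fintype.split l) => a [] b.
- by move/lshift_inj->.
- by move/eqP; rewrite eq_lrshift.
- by move/eqP; rewrite eq_rlshift.
- by move/rshift_inj/enum_val_inj ->.
Qed.

Lemma stack_col_mx (K : Type) p J (A : 'M[K]_(n, p)) (C : 'M[K]_(r, p)) :
  stack J (col_mx A C) = col_mx A (rowsub (fun i : 'I_#|J| => enum_val i) C).
Proof.
apply/matrixP => i j; rewrite mxE /stack_index [RHS]mxE; case: fintype.split => k.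
  by rewrite col_mxEu.
by rewrite col_mxEd mxE.
Qed.

Section Rank.
Variables (K : fieldType) (p : nat) (X : 'M[K]_(n + r, p)).
Local Notation rk J := (\rank (stack J X)).

Lemma stack_subP k J (B : 'M[K]_(k, p)) :
  reflect ((usubmx X <= B)%MS /\ forall j, j \in J -> (row j (dsubmx X) <= B)%MS)
    (stack J X <= B)%MS.
Proof.
have -> : stack J X = col_mx (usubmx X) (rowsub (fun i : 'I_#|J| => enum_val i) (dsubmx X)).
  by rewrite -stack_col_mx vsubmxK.
rewrite col_mx_sub; apply: (iffP andP) => -[AB CB]; split=> //.
  move=> j jJ; have := row_subP CB (enum_rank_in jJ j).
  by rewrite row_rowsub enum_rankK_in.
by apply/row_subP => i; rewrite row_rowsub; apply: CB; exact: enum_valP.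
Qed.

Lemma row_stack J j : j \in J -> (row j (dsubmx X) <= stack J X)%MS.
Proof. by move=> jJ; have /stack_subP[_] := submx_refl (stack J X); apply. Qed.

Lemma stackS J T : (forall j, j \in J -> (row j (dsubmx X) <= stack T X)%MS) ->
  (stack J X <= stack T X)%MS.
Proof. by move=> JT; apply/stack_subP; split=> //;
  have /stack_subP[] := submx_refl (stack T X). Qed.

(** The closure operator of the matroid of the lower rows modulo the span of the upper block. *)
Definition span_closure T : {set 'I_r} := [set j | (row j (dsubmx X) <= stack T X)%MS].

Lemma sub_span_closure T : T \subset span_closure T.
Proof. by apply/subsetP => j jT; rewrite inE row_stack. Qed.

Lemma rankS J T : J \subset T -> (rk J <= rk T)%N.
Proof. by move=> /subsetP JT; apply/mxrankS/stackS => j /JT/row_stack. Qed.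

Lemma rank_closureU T J : rk (span_closure T :|: J) = rk (T :|: J).
Proof.
apply/eqP; rewrite eqn_leq; apply/andP; split; last by rewrite rankS ?setSU ?sub_span_closure.
apply/mxrankS/stackS => j /setUP[|jJ]; last by rewrite row_stack // inE jJ orbT.
by rewrite inE => /submx_trans; apply; apply: stackS => i iT; rewrite row_stack // inE iT.
Qed.

Lemma rank_closure T : rk (span_closure T) = rk T.
Proof. by have := rank_closureU T set0; rewrite !setU0. Qed.

Lemma mem_span_closure T j : (j \in span_closure T) = (rk (j |: T) == rk T).
Proof.
have TjT : (stack T X <= stack (j |: T) X)%MS.
  by apply: stackS => i iT; rewrite row_stack // !inE iT orbT.
rewrite inE eq_sym (mxrank_leqif_sup TjT); apply/idP/idP => [jT|].
  by apply: stackS => i /setU1P[->//|]; exact: row_stack.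
by apply: submx_trans; rewrite row_stack // setU11.
Qed.

Lemma rank_setU1 T j : j \notin span_closure T -> rk (j |: T) = (rk T).+1.
Proof.
rewrite mem_span_closure => jT; apply/eqP; rewrite eqn_leq ltn_neqAle eq_sym jT.
rewrite [in X in _ && X]rankS ?subsetUr //= andbT.
have -> : (rk T).+1 = (rk T + 1)%N by rewrite addn1.
apply: leq_trans (leq_add (leqnn _) (rank_leq_row (row j (dsubmx X)))).
apply: leq_trans (mxrank_adds_leqif _ _); apply: mxrankS.
apply/stack_subP; split=> [|i /setU1P[->|iT]].
- by apply: submx_trans (addsmxSl _ _); have /stack_subP[] := submx_refl (stack T X).
- exact: addsmxSr.
by apply: submx_trans (addsmxSl _ _); exact: row_stack.
Qed.

Lemma sub_closure_rank T J : rk (T :|: J) = rk T -> J \subset span_closure T.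
Proof.
move=> e; apply/subsetP => j jJ; rewrite mem_span_closure eqn_leq andbC rankS ?subsetUr //=.
by rewrite -e rankS // setUC setUS // sub1set.
Qed.

Lemma span_closureK T : span_closure (span_closure T) = span_closure T.
Proof.
apply/eqP; rewrite eqEsubset sub_span_closure andbT; apply/subsetP => j.
by rewrite mem_span_closure setUC rank_closureU rank_closure setUC -mem_span_closure.
Qed.

End Rank.
End Selection.

Lemma colACE n r (A : 'M[bool]_n) (C : 'M[bool]_(r, n)) J :
  colAC A C J = stack J (col_mx A C).
Proof. by rewrite stack_col_mx. Qed.

(** * Generic realizations and the closed sets of the tree *)

Section Generic.
Variables (R : realType) (n r : nat) (A : 'M[bool]_n) (C : 'M[bool]_(r, n)).
Implicit Types J T : {set 'I_r}.

Lemma stack_parameter_values J (X : 'M[R]_(n + r, n)) :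
  parameter_values (col_mx A C) X -> parameter_values (colAC A C J) (stack J X).
Proof. by move=> MX i j; rewrite colACE mxE => /MX; rewrite mxE. Qed.

Lemma grank_colAC_attained J : exists2 X : 'M[R]_(n + r, n),
  parameter_values (col_mx A C) X & \rank (stack J X) = grank R (colAC A C J).
Proof.
have [Y MY <-] := grank_attained R (colAC A C J).
pose X : 'M[R]_(n + r, n) :=
  \matrix_(i, j) if [pick k | stack_index k == i] is Some k then Y k j else 0.
exists X => [i j|].
  by rewrite [X i j]mxE; case: pickP => // k /eqP <- Mkj; apply: MY; rewrite colACE mxE.
suff -> : stack J X = Y by [].
apply/matrixP => i j; rewrite !mxE; case: pickP => [k /eqP/stack_index_inj-> //|/(_ i)].
by rewrite eqxx.
Qed.

(** Induction over the sensor sets: on the segment from a realization generic for the sets already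
    treated to one generic for [J], only finitely many points lose one of these ranks. *)
Lemma generic_realization : exists2 X : 'M[R]_(n + r, n),
  parameter_values (col_mx A C) X & forall J, \rank (stack J X) = grank R (colAC A C J).
Proof.
suff [X MX rX] : exists2 X : 'M[R]_(n + r, n), parameter_values (col_mx A C) X &
    forall J, J \in enum {set 'I_r} -> (grank R (colAC A C J) <= \rank (stack J X))%N.
  exists X => // J; apply/eqP; rewrite eqn_leq rX ?mem_enum // andbT.
  exact/rank_le_grank/stack_parameter_values.
elim: (enum _) => [|J s [X MX rX]]; first by exists 0 => // i j _; rewrite mxE.
have [Y MY rY] := grank_colAC_attained J.
pose I := interpol X Y.
have [q q1 rq] := rank_le_specialization (stack J I) 1.
have [p p0 rp] : exists2 p : {poly R}, p != 0 & forall t, p.[t] != 0 ->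
    forall T, T \in s -> (\rank (stack T X) <= \rank (stack T (map_mx (horner_eval t) I)))%N.
  elim: (s) => [|T s' [p p0 rp]]; first by exists 1; rewrite ?oner_neq0.
  have [p' p'0 rp'] := rank_le_specialization (stack T I) 0.
  exists (p * p') => [|t]; first by rewrite mulf_neq0 //; apply: contraNneq p'0 => ->;
    rewrite horner0.
  rewrite hornerM mulf_eq0 negb_or => /andP[pt p't] T' /predU1P[->|/(rp t pt)//].
  by have := rp' t p't; rewrite /stack !map_mxsub [map_mx _ I in X in (X <= _)%N]interpol0.
have q0 : q != 0 by apply: contraNneq q1 => ->; rewrite horner0.
have [t] := exists_nonroot (mulf_neq0 p0 q0).
rewrite hornerM mulf_eq0 negb_or => /andP[pt qt].
exists (map_mx (horner_eval t) I) => [i j Mij|T /predU1P[->|Ts]].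
- by rewrite interpolE !mxE MX // MY // subr0 mulr0 addr0.
- by have := rq t qt; rewrite /stack !map_mxsub [map_mx _ I in X in (X <= _)%N]interpol1 -rY.
exact: leq_trans (rX T Ts) (rp t pt T Ts).
Qed.

Lemma mem_closed_layerS tau T :
  reflect (exists B j, [/\ B \in closed_layer R A C tau, j \notin B & T = Tbar R A C (j |: B)])
    (T \in closed_layer R A C tau.+1).
Proof.
apply: (iffP mapP) => [[U /flattenP[s /mapP[V Vt ->] /mapP[j jV ->]] ->]|[B [j [/mapP[V Vt ->]
  jV ->]]]].
  exists (Tbar R A C V), j; split=> //; first exact: map_f.
  by rewrite mem_enum inE in jV.
exists (j |: Tbar R A C V) => //; apply/flattenP; exists (children R A C V); first exact: map_f.
by apply: map_f; rewrite mem_enum inE.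
Qed.

Hypothesis full : grank R (col_mx A C) = n.
Local Notation gr J := (grank R (colAC A C J)).

Lemma grank_set0 : gr set0 = grank R A.
Proof.
apply/eqP; rewrite eqn_leq; apply/andP; split.
  have [X MX <-] := grank_attained R (colAC A C set0).
  rewrite -[X]vsubmxK -[X in (X <= _)%N](_ : \rank (usubmx X) = _).
    by apply: rank_le_grank => i j Aij; rewrite mxE MX // /colAC col_mxEu.
  rewrite -addsmxE; apply/esym/eqmx_rank/andP; rewrite addsmxSl addsmx_sub submx_refl; split=> //=.
  by apply/row_subP => i; exfalso; move: (nat_of_ord i) (ltn_ord i) => k; rewrite cards0.
have [Y MY <-] := grank_attained R A.
apply: leq_trans (_ : \rank (col_mx Y (0 : 'M_(#|(set0 : {set 'I_r})|, n))) <= _)%N.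
  by rewrite -addsmxE mxrankS // addsmxSl.
by apply: rank_le_grank => i j; rewrite /colAC !mxE; case: splitP => k _; [exact: MY|rewrite ?mxE].
Qed.

Lemma grank_setT : gr setT = n.
Proof.
apply/eqP; rewrite eqn_leq grank_le_col /= -{1}full.
have [X MX <-] := grank_attained R (col_mx A C).
apply: leq_trans (rank_le_grank (stack_parameter_values (J := setT) MX)).
apply: mxrankS; rewrite -{1}[X]vsubmxK col_mx_sub.
have /stack_subP[-> H] := submx_refl (stack setT X).
by apply/row_subP => i; apply: H; rewrite inE.
Qed.

(** For a realization generic for all sets at once, equality of generic ranks becomes membership in
    a span, so [Tbar] obeys the laws of a matroid closure. *)
Lemma TbarE (X : 'M[R]_(n + r, n)) T :
  (forall J, \rank (stack J X) = gr J) -> Tbar R A C T = span_closure X T.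
Proof.
move=> rX; apply/setP => j; rewrite mem_span_closure !inE !rX.
have [jT|//] := boolP (j \in T).
by rewrite (_ : j |: T = T) ?eqxx //; apply/setUidPr; rewrite sub1set.
Qed.

(** A child adds to a closed set one sensor outside it, which raises the rank by exactly one;
    closing up leaves the rank unchanged. *)
Lemma closed_layerP tau T : T \in closed_layer R A C tau ->
  gr T = (grank R A + tau)%N /\ Tbar R A C T = T.
Proof.
have [X MX rX] := generic_realization.
elim: tau T => [|tau IHtau] T.
  rewrite mem_seq1 => /eqP ->; rewrite !(TbarE _ rX) span_closureK.
  by rewrite -rX rank_closure rX grank_set0 addn0.
case/mem_closed_layerS => B [j [/IHtau[rB cB] jB ->]].
rewrite !(TbarE _ rX) span_closureK -rX rank_closure rank_setU1 ?rX ?rB ?addnS //.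
by rewrite -(TbarE _ rX) cB.
Qed.

Lemma exists_closed_layer J tau : (gr J < n)%N -> (grank R A + tau < n)%N ->
  exists2 T, T \in closed_layer R A C tau & (gr (T :|: J) < n)%N.
Proof.
have [X MX rX] := generic_realization.
move=> rJ; elim: tau => [|tau IHtau] rA.
  exists (Tbar R A C set0); first by rewrite mem_seq1.
  by rewrite (TbarE _ rX) -rX rank_closureU set0U rX.
have [|T Tt rTJ] := IHtau; first by rewrite (leq_ltn_trans _ rA) // leq_add2l.
have [rT cT] := closed_layerP Tt.
have child j : j \notin T -> (gr ((j |: T) :|: J) < n)%N ->
    exists2 T, T \in closed_layer R A C tau.+1 & (gr (T :|: J) < n)%N.
  move=> jT rj; exists (Tbar R A C (j |: T)); first by apply/mem_closed_layerS; exists T, j.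
  by rewrite (TbarE _ rX) -rX rank_closureU rX.
(* If [J] lies in [T], any sensor outside [T] will do, as the rank only grows to
   [grank R A + tau.+1]; one exists because all sensors together have rank [n]. Otherwise a sensor
   of [J] is added, which leaves the union with [J] unchanged. *)
have [JT|/subsetPn[j jJ jT]] := boolP (J \subset T).
  have [j jT] : exists j, j \notin T.
    apply: contrapT => H; have TT : T = setT.
      by apply/setP => j; rewrite inE; apply: contrapT => /negP jT; apply: H; exists j.
    by move: rTJ; rewrite TT setTU grank_setT ltnn.
  apply: (child j jT); rewrite -setUA (setUidPl JT) -rX rank_setU1 ?rX ?rT ?addnS //.
    by rewrite -addnS.
  by rewrite -(TbarE _ rX) cT.
by apply: (child j jT); rewrite -setUA (setUidPr _) // sub1set inE jJ orbT.
Qed.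

(** Closed sets of the last layer have rank [n.-1]. One of them still has rank below [n] together
    with the kept set [~: S], hence the same rank as alone, and being closed it contains [~: S]. *)
Lemma Jma_optimal J : deficiency R A != 0%N -> is_Jma R A C J ->
  (gr (~: J) < n)%N /\ forall S, (gr (~: S) < n)%N -> (#|J| <= #|S|)%N.
Proof.
rewrite /is_Jma /deficiency; case d: (n - grank R A)%N => [//|tau] _ [T [Tt maxT ->]].
have rAn : (grank R A + tau = n.-1 /\ 0 < n)%N by lia.
case: rAn => rAn n0.
split=> [|S rS]; first by rewrite setCK (closed_layerP Tt).1 rAn prednK.
have [|U Ut rU] := exists_closed_layer (tau := tau) rS; first by rewrite rAn prednK.
have [rU' cU] := closed_layerP Ut.
have [X MX rX] := generic_realization.
have SU : ~: S \subset U.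
  rewrite -cU (TbarE _ rX); apply: sub_closure_rank; rewrite !rX rU'; apply/eqP.
  rewrite eqn_leq rAn -ltnS prednK // rU /= -rAn -rU' -!rX; exact/rankS/subsetUl.
have := leq_trans (subset_leq_card SU) (maxT U Ut).
have := cardsC S; have := cardsC T; lia.
Qed.

End Generic.

(** * Sink components and optimality of the output *)

Lemma sink_scc_stable n (A : 'M[bool]_n) N u v :
  is_sink_scc A N -> u \in N -> connect (state_digraph A) u v -> v \in N.
Proof.
move=> [_ sink] uN; apply: (connect_stable (P := fun w => w \in N)) => // a b aN ab.
by apply: contraT => bN; move: (sink a b aN bN); rewrite ab.
Qed.

(** Among the vertices reachable from [x], one that reaches the fewest vertices lies in a sink
    component. *)
Lemma exists_sink_scc n (A : 'M[bool]_n) x :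
  exists2 N, is_sink_scc A N & forall z, z \in N -> connect (state_digraph A) x z.
Proof.
pose e := state_digraph A.
case: (@arg_minnP _ x (connect e x) (fun z => #|connect e z|) (connect0 e x)) => z xz minz.
exists [set y | connect e z y && connect e y z]; last first.
  by move=> y; rewrite inE => /andP[zy _]; exact: connect_trans xz zy.
split=> [|u v]; first by exists z.
rewrite !inE => /andP[zu uz]; apply: contra => uv.
have zv : connect e z v := connect_trans zu (connect1 uv).
rewrite zv /=; have sub : {subset connect e v <= connect e z} by move=> y; exact: connect_trans.
have sub' : connect e v \subset connect e z by apply/subsetP.
have eq_card : #|connect e v| = #|connect e z|.
  by apply/eqP; rewrite eqn_leq subset_leq_card // minz // (connect_trans xz).
have vz : z \in connect e v by rewrite (subset_cardP eq_card sub') inE connect0.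
exact: vz.
Qed.

Section Feasible.
Variables (R : realType) (n r : nat) (A : 'M[bool]_n) (C : 'M[bool]_(r, n)).
Implicit Types J S : {set 'I_r}.

Definition blinds S (x : 'I_n) : Prop :=
  forall z y, connect (state_digraph A) x z -> C y z -> y \in S.

Lemma blinds_senses S x : blinds S x <-> ~ senses A (subrows C (~: S)) x.
Proof.
split=> [bS [z [i [xz]]]|nS z y xz Cyz].
  by rewrite mxE => /(bS _ _ xz); have := enum_valP i; rewrite inE => /negP.
apply: contrapT => /negP yS; have yS' : y \in ~: S by rewrite inE.
by apply: nS; exists z, (enum_rank_in yS' y); rewrite mxE enum_rankK_in.
Qed.

Lemma feasibleP S :
  feasible R A C S <-> (exists x, blinds S x) \/ (grank R (colAC A C (~: S)) < n)%N.
Proof.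
split=> [nobs|]; last first.
  move=> bad /struct_observableP[all_sense gn]; case: bad => [[x /blinds_senses]|]; first by apply.
  by rewrite /colAC gn ltnn.
have [x_blind|no_blind] := pselect (exists x, blinds S x); [by left|right].
rewrite ltnNge; apply/negP => gn; apply: nobs; apply/struct_observableP; split.
  by move=> x; apply: contrapT => /blinds_senses bx; apply: no_blind; exists x.
by apply/eqP; rewrite eqn_leq grank_le_col.
Qed.

(** Removing the sensors of a sink component blinds its states, since no edge leaves it. Conversely,
    blinding [x] removes all sensors of some sink component reachable from [x]. *)
Lemma Jre_optimal J : is_Jre A C J ->
  (exists x, blinds J x) /\ forall S x, blinds S x -> (#|J| <= #|S|)%N.
Proof.
move=> [[N sinkN ->] minN]; split=> [|S x bS].
  case: (sinkN) => -[x NE] _; exists x => z y xz Cyz; rewrite inE; apply/existsP; exists z.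
  by rewrite Cyz (sink_scc_stable sinkN _ xz) // NE inE !connect0.
have [M sinkM xM] := exists_sink_scc A x.
apply: leq_trans (minN M sinkM) _; apply/subset_leq_card/subsetP => y.
by rewrite inE => /existsP[z /andP[/xM xz Cyz]]; exact: bS xz Cyz.
Qed.

Lemma output_optimal J : (0 < n)%N -> struct_observable R A C ->
  algorithm_output R A C J -> optimal R A C J.
Proof.
move=> n0 /struct_observableP[_ full] [Jma [Jre [is_ma is_re Jin leJma leJre]]].
have [re_blind re_min] := Jre_optimal is_re.
have re_feasible : feasible R A C Jre by apply/feasibleP; left.
suff [ma_feasible ma_min] : feasible R A C Jma /\
    forall S, (grank R (colAC A C (~: S)) < n)%N -> (#|Jma| <= #|S|)%N.
  split=> [|S /feasibleP[[x bS]|gS]].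
  - by move: Jin; rewrite !inE => /orP[/eqP->|/eqP->].
  - exact: leq_trans leJre (re_min S x bS).
  - exact: leq_trans leJma (ma_min S gS).
have [d0|d] := eqVneq (deficiency R A) 0%N; last first.
  have [gJ minJ] := Jma_optimal full d is_ma.
  by split=> //; apply/feasibleP; right.
(* With deficiency 0 every sensor set satisfies the rank condition, so only reachability can fail;
   removing all sensors blinds any state. *)
have gn S : (n <= grank R (colAC A C S))%N.
  have [X MX rX] := generic_realization R A C.
  rewrite -rX; apply: leq_trans (rankS X (sub0set S)).
  by rewrite rX grank_set0; move: d0; rewrite /deficiency; lia.
move: is_ma; rewrite /is_Jma d0 => ->; split=> [|S]; last by rewrite ltnNge gn.
by apply/feasibleP; left; exists (Ordinal n0) => z y _ _; rewrite inE.
Qed.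

End Feasible.

(** * Depth-first search *)

Section Loops.
Local Open Scope nat_scope.

(** The invariant sees the processed prefix, the state and the steps spent; the successor in the
    second premise is the step charged per iteration. *)
Lemma for_each_ind X S (body : X -> S -> timed S) (I : seq X -> S -> nat -> Prop)
    (s : seq X) (st : S) :
  I [::] st 0 ->
  (forall d x d' st k, s = d ++ x :: d' -> I d st k ->
     I (rcons d x) (body x st).1 (k + (body x st).2).+1) ->
  I s (for_each s body st).1 (for_each s body st).2.
Proof.
move=> I0 IS.
suff H d k d' : s = d ++ d' -> forall st, I d st k ->
    I s (for_each d' body st).1 (k + (for_each d' body st).2).
  by rewrite -[X in I _ _ X]add0n; apply: (H [::]).
elim: d' d k => [|x d' IHd] d k sE st' Id /=; first by move: Id; rewrite sE cats0 addn0.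
have := IHd (rcons d x) _ _ _ (IS d x d' _ _ sE Id); rewrite cat_rcons => /(_ sE).
by congr (I _ _ _); lia.
Qed.

Lemma sum_card_disjoint (T : finType) (X : eqType) (F : X -> {set T}) (s : seq X) :
  pairwise (fun a b => [disjoint F a & F b]) s ->
  \sum_(a <- s) #|F a| = #|\bigcup_(a <- s) F a|.
Proof.
elim: s => [|a s IHs] /=; first by rewrite !big_nil cards0.
case/andP => as_ /IHs; rewrite !big_cons => ->.
suff disj : F a :&: \bigcup_(b <- s) F b = set0 by rewrite cardsU disj cards0 subn0.
elim: s as_ {IHs} => [|b s IHs] /=; first by rewrite big_nil setI0.
case/andP; rewrite -setI_eq0 => /eqP ab /IHs sab.
by rewrite big_cons setIUr ab sab setU0.
Qed.

End Loops.

Section Search.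
Local Open Scope nat_scope.
Variables (n : nat) (e : rel 'I_n) (edge : 'I_n -> 'I_n -> timed bool).
Hypothesis edgeE : forall u v, edge u v = steps 1 (e u v).

(** The four steps per vertex are the loop step, the edge query, the membership test and the
    insertion. *)
Lemma search_step u stack (V : {set 'I_n}) :
  let m := for_each (enum 'I_n) (fun v st' =>
        let* b := edge u v in
        let* seen := test v st'.2 in
        if b && ~~ seen then
          let* vis' := insert v st'.2 in ret (v :: st'.1, vis')
        else ret st') (stack, V) in
  (exists new : seq 'I_n,
    [/\ m.1.1 = new ++ stack, uniq new, m.1.2 = V :|: [set v in new] &
      forall v, (v \in new) = e u v && (v \notin V)]) /\ m.2 <= 4 * n.
Proof.
pose I (d : seq 'I_n) (st : seq 'I_n * {set 'I_n}) k :=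
  (exists new : seq 'I_n,
    [/\ st.1 = new ++ stack, uniq new, st.2 = V :|: [set v in new] &
      forall v, (v \in new) = [&& v \in d, e u v & v \notin V]]) /\ k <= 4 * size d.
rewrite /=; have := @for_each_ind _ _ _ I (enum 'I_n) (stack, V) _ _.
set body := (X in for_each _ X).
move=> /(_ body)[||[new [-> un -> newE]]]; first 2 last.
- rewrite size_enum_ord => k4; split=> //; exists new; split=> // v.
  by rewrite newE mem_enum.
- split=> //; exists [::]; split=> //; apply/setP => v; by rewrite !inE orbF.
move=> d v d' st k sE [[new [s1 un s2 newE]] kd].
have vd : v \notin d.
  by have := enum_uniq 'I_n; rewrite sE cat_uniq /= => /and3P[_ /norP[]].
rewrite /I /body edgeE /= size_rcons; case: ifP => [/andP[uv]|] /=; last first.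
  move=> old; split; last lia; exists new; split=> // w.
  rewrite newE mem_rcons inE; have [->|//] := eqVneq w v.
  rewrite (negPf vd) /=; apply/esym/negbTE; move/negbT: old; apply: contra => /andP[-> vV].
  by rewrite s2 !inE (negPf vV) newE (negPf vd).
rewrite s2 !inE negb_or => /andP[vV vnew]; split; last lia.
exists (v :: new); split=> //=; [by rewrite s1|by rewrite vnew| |].
  by apply/setP => w; rewrite !inE; case: (w == v) => //=; rewrite orbT.
by move=> w; rewrite inE mem_rcons inE newE; have [->|//] := eqVneq w v; rewrite uv vV.
Qed.

(** As [vis] is closed under edges, never re-entering it loses no vertex. The cost is charged to the
    newly visited vertices, so that successive searches telescope. *)
Lemma searchP w (vis : {set 'I_n}) :
  (forall a b, a \in vis -> e a b -> b \in vis) -> w \notin vis ->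
  let m := search edge w vis in
  m.1 = vis :|: [set y | connect e w y] /\
  m.2 + 4 * n * #|vis| <= 1 + n + 4 * n * #|m.1|.
Proof.
move=> vis_closed wvis.
(* The number [p] counts expanded vertices. As long as the stack is nonempty every round expands
   one, so a nonempty stack after [n] rounds would mean more than [n] visited vertices. *)
pose I (d : seq 'I_n) (st : seq 'I_n * {set 'I_n}) k :=
  [/\ uniq st.1 && all (fun a => (a \in st.2) && (a \notin vis)) st.1,
     vis \subset st.2 /\ w \in st.2,
     (forall a, a \in st.2 -> a \in vis \/ connect e w a),
     (forall a, a \in st.2 -> a \notin st.1 -> forall b, e a b -> b \in st.2)
   & exists p, [/\ #|st.2| = #|vis| + size st.1 + p, st.1 = [::] \/ size d <= p
                & k <= size d + 4 * n * p]].
rewrite /search /=.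
set body := (X in for_each _ X); set m := for_each _ _ _.
suff [/andP[um stm] [vm wm] mP mclosed [p [cm done_ km]]] : I (enum 'I_n) m.1 m.2.
  have st0 : m.1.1 = [::].
    have Vn : #|m.1.2| <= n by rewrite -[X in _ <= X]card_ord max_card.
    case: done_ => //; rewrite size_enum_ord => np; case: m.1.1 cm => //= a l cm; move: Vn;
      rewrite cm => Vn; exfalso; clear -Vn np; lia.
  have mE : m.1.2 = vis :|: [set y | connect e w y].
    apply/setP => y; rewrite !inE; apply/idP/orP => [/mP//|[|wy]].
      by move: y; exact/subsetP.
    have step a b : a \in m.1.2 -> e a b -> b \in m.1.2.
      by move=> am; apply: mclosed; rewrite ?st0.
    case/connectP: wy => q + ->; elim: q (w) wm => //= a q IHq x xm /andP[xa].
    by apply: IHq; exact: step xa.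
  split; first exact: mE.
  rewrite cm st0 /= addn0 mulnDr; move: km; rewrite size_enum_ord; lia.
rewrite {}/m; apply: for_each_ind => [|d x d' [stk V] k _]; rewrite {}/I {}/body.
  rewrite /= setU11 wvis subsetUr; split=> //.
  - by move=> a /setU1P[->|]; [right|left].
  - move=> a /setU1P[->|av]; rewrite inE ?eqxx // => _ b /(vis_closed _ _ av) bv.
    by rewrite inE bv orbT.
  - by exists 0; split; [rewrite cardsU1 wvis /=; lia|right|].
move=> [/= /andP[us sV] [visV wV] VP Vclosed [p [cV done_ kp]]].
rewrite size_rcons; case: stk => [|u stk] in us sV Vclosed cV done_ *.
  by split=> //=; exists p; split=> //; [left|lia].
rewrite /=; have [/= [new [-> un -> newE]]] := search_step u stk V.
set t := (X in X <= _) => ht; move: us sV => /= /andP[ustk us] /andP[/andP[uV uvis] sV].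
have newV a : a \in new -> a \notin V by rewrite newE => /andP[].
have cnew : #|V :|: [set v in new]| = #|V| + size new.
  rewrite cardsU (_ : V :&: _ = set0) ?cards0 ?subn0.
    by congr (_ + _); rewrite cardsE; exact/card_uniqP.
  apply/setP => a; rewrite !inE; apply/negbTE/negP => /andP[aV /newV]; by rewrite aV.
split.
- rewrite cat_uniq un us andbT /=; apply/andP; split.
    apply/hasPn => a /(allP sV)/andP[aV _]; apply/negP => /newV; by rewrite aV.
  rewrite all_cat; apply/andP; split; apply/allP => a.
    move=> an; rewrite !inE an orbT /=; apply: contra (newV a an).
    exact: (subsetP visV).
  by move=> /(allP sV)/andP[aV ->]; rewrite inE aV.
- by split; [exact: subset_trans visV (subsetUl _ _)|rewrite inE wV].
- move=> a; rewrite !inE => /orP[/VP//|]; rewrite newE => /andP[ua _]; right.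
  have [uv|wu] := VP u uV; first by rewrite uv in uvis.
  exact: connect_trans wu (connect1 ua).
- move=> a; rewrite !inE mem_cat negb_or => /orP[aV|an] /andP[anew astk] b ab;
  last by rewrite an in anew.
  have [au|au] := eqVneq a u; first by rewrite !inE newE -au ab; case: (b \in V).
  by rewrite inE (Vclosed a aV) // inE negb_or au.
exists p.+1; split; [|by right; case: done_ => //=|].
  by rewrite cnew cV size_cat /=; lia.
by rewrite mulnS; lia.
Qed.
End Search.

(** * Computation of the sink components *)

Section SinkComponents.
Local Open Scope nat_scope.
Variables (n : nat) (A : 'M[bool]_n).
Local Notation reach := (connect (state_digraph A)).

(** Applied with [Q a b := ~~ reach a b] in the second pass, which runs through the
    output of the first one: the two orders together separate the roots. *)
Lemma search_rootsP (Q : rel 'I_n) (order : seq 'I_n) : pairwise Q order ->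
  let m := search_roots A order in
  [/\ pairwise (fun a b => ~~ reach a b && Q b a) m.1,
      {subset m.1 <= order}, size m.1 <= n,
      forall v, v \in order -> exists2 w, w \in m.1 & reach v w
    & m.2 <= n + (3 + n) * size order + 4 * n * n].
Proof.
move=> Qorder; rewrite /search_roots.
set body := (X in for_each _ X); rewrite /=; set m := for_each _ _ _.
pose I (d : seq 'I_n) (st : seq 'I_n * {set 'I_n}) k :=
  [/\ pairwise (fun a b => ~~ reach a b && Q b a) st.1,
      {subset st.1 <= d}, {subset d <= st.2},
      forall v, (v \in st.2) = has (reach v) st.1
    & size st.1 <= #|st.2| /\ k <= (3 + n) * size d + 4 * n * #|st.2|].
suff [pw sub sup VE [sz km]] : I order m.1 m.2.
  have Vn : #|m.1.2| <= n by rewrite -[X in _ <= X]card_ord max_card.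
  split=> // [|v /sup|].
  - exact: leq_trans sz Vn.
  - by rewrite VE => /hasP[w wm vw]; exists w.
  have : 4 * n * #|m.1.2| <= 4 * n * n by rewrite leq_mul2l Vn orbT.
  by move: km; lia.
apply: for_each_ind => [|d v d' [roots V] k dE [/= pw sub sup VE [sz kd]]]; rewrite /I.
  by split=> //= v; rewrite !inE.
have Vclosed a b : a \in V -> state_digraph A b a -> b \in V.
  rewrite !VE => /hasP[w wr aw] ba; apply/hasP; exists w => //.
  exact: connect_trans (connect1 ba) aw.
have := @searchP n (fun a b => state_digraph A b a) (backward A) (fun _ _ => erefl) v V Vclosed.
rewrite /body; cbv beta; move: (search _ v V) => t.
rewrite /= size_rcons; case: ifP => /= [vV _|/negbT vV /(_ isT)[tE tt]].
  split=> // [w wr|w|].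
  - by rewrite mem_rcons inE sub ?orbT.
  - by rewrite mem_rcons inE => /predU1P[->|/sup].
  by split; lia.
have t1 y : (y \in t.1) = (y \in V) || reach y v.
  by rewrite tE !inE; congr (_ || _); exact: connect_rev.
have vt : v \in t.1 by rewrite t1 connect0 orbT.
have cVt : #|V| < #|t.1|.
  apply: proper_card; apply/properP; split; last by exists v.
  by apply/subsetP => y yV; rewrite t1 yV.
split=> [|w|w|w|] /=.
- rewrite pw andbT; apply/allP => w wr; apply/andP; split.
    apply: contra vV => vw; rewrite VE; apply/hasP; by exists w.
  move: Qorder; rewrite dE pairwise_cat => /and3P[/allrelP H _ _]; apply: H; first exact: sub.
  exact: mem_head.
- by rewrite !inE mem_rcons inE => /predU1P[->|/sub->]; rewrite ?eqxx ?orbT.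
- by rewrite mem_rcons inE t1 => /predU1P[->|/sup->//]; rewrite connect0 orbT.
- by rewrite t1 VE orbC.
split; first exact: leq_ltn_trans sz cVt.
rewrite mulnS; move: kd tt;
  move: (4 * n * #|V|) (4 * n * #|t.1|) ((3 + n) * size d) => x y z kd tt; lia.
Qed.

Lemma pairwise_sym_all (T : eqType) (r : rel T) (s : seq T) a b :
  symmetric r -> pairwise r s -> a \in s -> b \in s -> a != b -> r a b.
Proof.
move=> sr; elim: s => //= x s IHs /andP[/allP xs ps] /predU1P[->|a_s] /predU1P[->|b_s] ab.
- by rewrite eqxx in ab.
- exact: xs.
- by rewrite sr xs.
exact: IHs.
Qed.

(** After both passes no representative reaches another, while every vertex reaches one. Hence all
    that a representative reaches leads back to it, and its forward search finds a sink
    component. *)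
Lemma sink_sccsP :
  let m := sink_sccs A in
  [/\ forall N, N \in m.1 <-> is_sink_scc A N,
      \sum_(N <- m.1) #|N| <= n, size m.1 <= n
    & m.2 <= 16 * n * n + 10 * n].
Proof.
have all_true (s : seq 'I_n) : pairwise (fun _ _ => true) s.
  by elim: s => //= x s ->; rewrite andbT; apply/allP.
have [pw1 _ sz1 roots1 t1] := search_rootsP (all_true (enum 'I_n)).
have [pw2 sub2 sz2 roots2 t2] := search_rootsP pw1.
rewrite /sink_sccs /bind; cbv beta zeta.
move: pw1 sz1 roots1 t1 pw2 sub2 sz2 roots2 t2.
move: (search_roots A (enum 'I_n)) => m1.
move: (search_roots A m1.1) => m2 pw1 sz1 roots1 t1 pw2 sub2 sz2 roots2 t2.
set reps := m2.1 in sz2 pw2 sub2 roots2 *.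
have inc a b : a \in reps -> b \in reps -> reach a b -> a = b.
  move=> ar br ab; apply/eqP; apply: contraT => neq.
  have /(_ reps a b _ _ ar br neq) := @pairwise_sym_all _ (fun a b => ~~ reach a b && ~~ reach b a).
  rewrite ab; apply=> [x y|]; first by rewrite andbC.
  apply: sub_pairwise pw2 => x y; by rewrite andbT.
have to_rep v : exists2 w, w \in reps & reach v w.
  have [|w wr vw] := roots1 v; first by rewrite mem_enum.
  by have [u ur wu] := roots2 w wr; exists u => //; exact: connect_trans vw wu.
pose F (w : 'I_n) := [set y | reach w y].
have repF w : w \in reps -> is_sink_scc A (F w).
  move=> wr; split=> [|u v]; last first.
    by rewrite !inE => wu; apply: contra => uv; exact: connect_trans wu (connect1 uv).
  exists w; apply/setP => y; rewrite !inE; apply/idP/andP => [wy|[]//]; split=> //.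
  have [w' w'r yw'] := to_rep y.
  by rewrite (inc w w' wr w'r (connect_trans wy yw')).
(* The components are disjoint, which keeps the total cost of the forward searches quadratic in
   [n]. *)
have sumF : \sum_(w <- reps) #|F w| <= n.
  rewrite sum_card_disjoint; first by rewrite -[X in _ <= X]card_ord max_card.
  apply: (sub_in_pairwise (P := mem reps) _ _ pw2); last exact/allP.
  move=> x y xr yr; rewrite andbT => /andP[/negP xy _]; rewrite -setI_eq0; apply/eqP/setP => v.
  rewrite !inE; apply/negP => /andP[xv yv]; apply: xy; have [w wr vw] := to_rep v.
  by rewrite (inc x w xr wr (connect_trans xv vw)) -(inc y w yr wr (connect_trans yv vw)).
set body := (X in for_each _ X).
have [] : (for_each reps body [::]).1 = rev (map F reps) /\
   (for_each reps body [::]).2 <= (2 + 2 * n) * size reps + 4 * n * \sum_(w <- reps) #|F w|.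
  apply: (@for_each_ind _ _ body (fun d acc k => acc = rev (map F d) /\
    k <= (2 + 2 * n) * size d + 4 * n * \sum_(w <- d) #|F w|)) => [|d w d' acc k _ [-> kd]] //.
  have := @searchP n (state_digraph A) (forward A) (fun _ _ => erefl) w set0.
  rewrite /body /new_empty /bind; cbv beta zeta; rewrite -![(steps n set0).1]/set0.
  move: (search _ _ set0) => m [||mE mt].
  - by move=> a b; rewrite inE.
  - by rewrite inE.
  rewrite /= map_rcons rev_rcons mE set0U; split=> //.
  move: mt; rewrite cards0 muln0 addn0 mE set0U size_rcons -cats1 big_cat big_seq1 /= mulnS mulnDr.
  by move: kd; rewrite -/(F w);
    move: ((2 + 2 * n) * size d) (4 * n * \sum_(w <- d) _) (4 * n * #|F w|) => x y z; lia.
move=> -> t3; split.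
- move=> N; rewrite mem_rev; split=> [/mapP[w wr ->]|sinkN]; first exact: repF.
  case: (sinkN) => -[x NE] _; have [w wr xw] := to_rep x; apply/mapP; exists w => //.
  have wN : w \in N by apply: (sink_scc_stable sinkN _ xw); rewrite NE inE !connect0.
  move: wN; rewrite NE => /[!inE] /andP[_ wx].
  apply/setP => y; rewrite !inE; apply/andP/idP => [[xy _]|wy]; first exact: connect_trans wx xy.
  split; first exact: connect_trans xw wy.
  have [u ur yu] := to_rep y; have wu := inc w u wr ur (connect_trans wy yu).
  by rewrite -wu in yu; exact: connect_trans yu wx.
- rewrite (perm_big (map F reps)) ?perm_rev //= big_map. exact: sumF.
- by rewrite size_rev size_map.
have := leq_mul (leqnn (3 + n)) sz1; have := leq_mul (leqnn (2 + 2 * n)) sz2.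
have := leq_mul (leqnn (4 * n)) sumF.
move: t1 t2 t3; rewrite size_enum_ord.
move: ((3 + n) * size m1.1) ((2 + 2 * n) * size reps) (4 * n * \sum_(w <- reps) _) => x y z.
move: (for_each _ _ _).2 m1.2 m2.2 => u v w /=; lia.
Qed.
End SinkComponents.

(** * Sets of extremal cardinality *)

Section SmallestLargest.
Local Open Scope nat_scope.
Variable r : nat.
Implicit Types (s : seq {set 'I_r}) (S : {set 'I_r}).

Lemma smallestP s S0 :
  let m := smallest s S0 in
  [/\ m.1 \in S0 :: s, forall S, S \in S0 :: s -> #|m.1| <= #|S|
    & m.2 <= size s * (2 * r + 2)].
Proof.
rewrite /smallest; set body := (X in for_each _ X); rewrite /=.
apply: (@for_each_ind _ _ body (fun d best k => [/\ best \in S0 :: d,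
  forall S, S \in S0 :: d -> #|best| <= #|S| & k <= size d * (2 * r + 2)])).
  by split=> [|S|]; rewrite ?inE // => /eqP ->.
move=> d S d' best k _ [bd bmin kd]; rewrite /body /= size_rcons -rcons_cons; split.
- by case: ifP => _; rewrite mem_rcons inE ?eqxx ?bd ?orbT.
- move=> T; rewrite mem_rcons inE => /predU1P[->|/bmin bT]; case: ltnP => //.
  by move=> /ltnW Sb; exact: leq_trans Sb bT.
rewrite mulSn; lia.
Qed.

Lemma largestP s S0 :
  let m := largest s S0 in
  [/\ m.1 \in S0 :: s, forall S, S \in S0 :: s -> #|S| <= #|m.1|
    & m.2 <= size s * (2 * r + 2)].
Proof.
rewrite /largest; set body := (X in for_each _ X); rewrite /=.
apply: (@for_each_ind _ _ body (fun d best k => [/\ best \in S0 :: d,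
  forall S, S \in S0 :: d -> #|S| <= #|best| & k <= size d * (2 * r + 2)])).
  by split=> [|S|]; rewrite ?inE // => /eqP ->.
move=> d S d' best k _ [bd bmax kd]; rewrite /body /= size_rcons -rcons_cons; split.
- by case: ifP => _; rewrite mem_rcons inE ?eqxx ?bd ?orbT.
- move=> T; rewrite mem_rcons inE => /predU1P[->|/bmax bT]; case: ltnP => //.
  by move=> /ltnW Sb; exact: leq_trans bT Sb.
rewrite mulSn; lia.
Qed.
End SmallestLargest.

(** * Sensors of the sink components *)

Section Sensors.
Local Open Scope nat_scope.
Variables (n r : nat) (A : 'M[bool]_n) (C : 'M[bool]_(r, n)).

(** The inner loop runs only for members of [N], so the total over disjoint components stays
    quadratic. *)
Lemma sensors_ofP N :
  let m := sensors_of C N in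
  m.1 = out_sensors C N /\ m.2 <= r + 2 * n + 3 * r * #|N|.
Proof.
rewrite /sensors_of /bind; cbv beta zeta; set body := (X in for_each _ X); rewrite /=.
have inner x J : let m := for_each (enum 'I_r) (fun j J' =>
        let* c := entry C j x in
        if c then insert j J' else ret J') J in
    m.1 = J :|: [set j | C j x] /\ m.2 <= 3 * r.
  set ibody := (X in for_each _ X); rewrite /=.
  have [] : (for_each (enum 'I_r) ibody J).1 = J :|: [set j in enum 'I_r | C j x] /\
      (for_each (enum 'I_r) ibody J).2 <= 3 * size (enum 'I_r).
    apply: (@for_each_ind 'I_r _ ibody (fun d J' k => J'
      = J :|: [set j in d | C j x] /\ k <= 3 * size d)).
      by split=> //; apply/setP => j; rewrite !inE orbF.
    move=> d j d' J' k _ [-> kd]; rewrite /ibody /= size_rcons; split;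
      last by case: ifP => _ /=; lia.
    apply/setP => i; case: ifP => Cjx; rewrite !inE mem_rcons inE.
      by have [->|_] := eqVneq i j; rewrite ?Cjx ?orbT.
    by have [->|_] := eqVneq i j; rewrite ?Cjx ?andbF.
  move=> -> ; rewrite size_enum_ord; split=> //; congr (_ :|: _).
  by apply/setP => j; rewrite !inE mem_enum.
have [mE mt] : (for_each (enum 'I_n) body set0).1
  = [set j | has (fun x => (x \in N) && C j x) (enum 'I_n)] /\
    (for_each (enum 'I_n) body set0).2 <= 2 * size (enum 'I_n) + 3 * r * count (mem N) (enum 'I_n).
  apply: (@for_each_ind 'I_n _ body (fun d J k => J
    = [set j | has (fun x => (x \in N) && C j x) d] /\
      k <= 2 * size d + 3 * r * count (mem N) d)).
    by split=> //; apply/setP => j; rewrite !inE.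
  move=> d x d' J k _ [-> kd]; rewrite /body /= size_rcons -cats1 count_cat /= addn0 mulnDr.
  have [xN|xN] /= := boolP (x \in N).
    have := inner x [set j | has (fun x => (x \in N) && C j x) d].
    move: (for_each _ _ _) => m [-> mt]; split; last by rewrite muln1;
      move: (3 * r * count _ _) kd => y kd; lia.
    by apply/setP => j; rewrite !inE has_cat /= xN orbF.
  split; last by rewrite muln0; move: (3 * r * count _ _) kd => y kd; lia.
  by apply/setP => j; rewrite !inE has_cat /= (negPf xN) /= orbF.
split.
  rewrite mE; apply/setP => j; rewrite !inE; apply/hasP/existsP => [[x _ xP]|[x xP]];
    exists x => //.
  by rewrite mem_enum.
have cN : count (mem N) (enum 'I_n) = #|N| by rewrite cardE -size_filter enumT.
by move: mt; rewrite size_enum_ord cN; move: (for_each _ _ _).2 (3 * r * #|N|) => t y /= mt; lia.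
Qed.

Lemma compute_JreP : 0 < n ->
  let m := compute_Jre A C in
  is_Jre A C m.1 /\ m.2 <= 40 * (r + n) * (r + n).
Proof.
move=> n0; rewrite /compute_Jre /bind; cbv beta zeta.
have := sink_sccsP A; move: (sink_sccs A) => m1 [].
move: m1.1 m1.2 => Ns t1 NsP sumN szN t1_le.
set body := (X in for_each Ns X).
have [] : (for_each Ns body [::]).1 = rev (map (out_sensors C) Ns) /\
    (for_each Ns body [::]).2 <= (1 + r + 2 * n) * size Ns + 3 * r * \sum_(N <- Ns) #|N|.
  apply: (@for_each_ind _ _ body (fun d acc k => acc = rev (map (out_sensors C) d) /\
      k <= (1 + r + 2 * n) * size d + 3 * r * \sum_(N <- d) #|N|)) => [|d N d' acc k _ [-> kd]] //.
  have := sensors_ofP N; rewrite /body; cbv beta; move: (sensors_of C N) => [J t] /= [-> tJ].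
  rewrite map_rcons rev_rcons size_rcons; split=> //.
  rewrite -cats1 big_cat big_seq1 /= mulnS mulnDr; move: tJ kd.
  move: (3 * r * #|N|) (3 * r * \sum_(N <- d) _) ((1 + r + 2 * n) * size d) => x y z; lia.
move: (for_each Ns body [::]) => [Js t2] /= -> t2_le.
have := smallestP (rev (map (out_sensors C) Ns)) setT.
move: (smallest _ _) => [J t3] [/= Jin Jmin t3_le].
have [N0 N0s _] := exists_sink_scc A (Ordinal n0).
have N0in : out_sensors C N0 \in setT :: rev (map (out_sensors C) Ns).
  by rewrite inE mem_rev map_f ?orbT //; apply/NsP.
split.
  split=> [|N sinkN]; last by apply: Jmin; rewrite inE mem_rev map_f ?orbT //; apply/NsP.
  (* If the starting value [V] is returned, the sensor set of [N0] is at least as large, hence equal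
     to [V]. *)
  move: Jin; rewrite inE mem_rev => /predU1P[JT|/mapP[N /NsP sinkN ->]]; last by exists N.
  exists N0 => //; rewrite JT; apply/esym/eqP; rewrite eqEcard subsetT -JT.
  exact: Jmin.
move: t3_le; rewrite size_rev size_map.
have := leq_mul szN (leqnn (2 * r + 2)); have := leq_mul (leqnn (1 + r + 2 * n)) szN.
have := leq_mul (leqnn (3 * r)) sumN.
move: t2_le; move: (_ * size Ns) (size Ns * _) (_ * \sum_(N <- Ns) _) => x y z.
nia.
Qed.
End Sensors.

(** * The tree of closed sets *)

Section Jma.
Local Open Scope nat_scope.
Variables (R : realType) (gr : grank_procedure) (n r G : nat).
Variables (A : 'M[bool]_n) (C : 'M[bool]_(r, n)).
Hypothesis grE : forall J : {set 'I_r}, (gr A C J).1 = grank R (colAC A C J).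
Hypothesis gr_le : forall J : {set 'I_r}, (gr A C J).2 <= G.

(** One generic rank and one copy for [T]; then for each sensor at most one generic rank, one copy
    and a few single steps. *)
Definition Tbar_bound := G + r + r * (G + r + 6).

Lemma compute_TbarP T :
  (compute_Tbar gr A C T).1 = Tbar R A C T /\ (compute_Tbar gr A C T).2 <= Tbar_bound.
Proof.
rewrite /compute_Tbar /bind; cbv beta zeta; set body := (X in for_each _ X).
pose close (d : seq 'I_r) :=
  T :|: [set j in ~: T | (j \in d) && (grank R (colAC A C (j |: T)) == grank R (colAC A C T))].
have [] : (for_each (enum 'I_r) body T).1 = close (enum 'I_r) /\
    (for_each (enum 'I_r) body T).2 <= size (enum 'I_r) * (G + r + 6).
  apply: (@for_each_ind 'I_r _ body (fun d B k => B = close d /\ k <= size d * (G + r + 6))).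
    by split=> //; apply/setP => j; rewrite !inE andbF orbF.
  move=> d j d' B k _ [-> kd]; rewrite /body /= size_rcons mulSn.
  have [jT|jT] := boolP (j \in T).
    split; last by rewrite /=; lia.
    apply/setP => i; rewrite !inE mem_rcons inE; have [->|//] := eqVneq i j.
    by rewrite jT.
  have := gr_le (j |: T); rewrite !grE => gT.
  split; last by case: ifP => _ /=; lia.
  apply/setP => i; case: ifP => eqj; rewrite !inE mem_rcons inE.
    by have [->|_] := eqVneq i j; rewrite ?jT ?eqj ?orbT.
  by have [->|_] := eqVneq i j; rewrite ?eqj ?andbF.
rewrite size_enum_ord /= => -> kd; split.
  by apply/setP => j; rewrite !inE mem_enum.
by have := gr_le T; rewrite /Tbar_bound; move: (r * _) kd => y kd; lia.
Qed.

Lemma next_closed_layerP (Bs : seq {set 'I_r}) :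
  let m := next_closed_layer gr A C Bs in
  [/\ forall T, T \in m.1 <-> exists B j, [/\ B \in Bs, j \notin B & T = Tbar R A C (j |: B)],
      size m.1 <= size Bs * r & m.2 <= size Bs * (1 + r * (3 + r + Tbar_bound))].
Proof.
rewrite /next_closed_layer; cbv zeta; set body := (X in for_each _ X).
have inner B acc : let m := body B acc in
   [/\ m.1 =i [seq Tbar R A C (j |: B) | j <- enum 'I_r & j \notin B] ++ acc,
       size m.1 <= size acc + r & m.2 <= r * (3 + r + Tbar_bound)].
  rewrite /body; cbv zeta; set ibody := (X in for_each _ X).
  rewrite -[X in _ <= _ + X]size_enum_ord -[X in _ <= X * _]size_enum_ord.
  apply: (@for_each_ind 'I_r _ ibody (fun d acc' k =>
    [/\ acc' =i [seq Tbar R A C (j |: B) | j <- d & j \notin B] ++ acc,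
       size acc' <= size acc + size d & k <= size d * (3 + r + Tbar_bound)])) => //.
    by split; rewrite ?addn0.
  move=> d j d' acc' k _ [aE sz kd]; rewrite /ibody /bind; cbv beta zeta.
  rewrite -[(test j B).1]/(j \in B) size_rcons filter_rcons mulSn.
  case: (boolP (j \in B)) => jB; cbv beta iota delta [negb].
    by split=> //=; lia.
  have := compute_TbarP (insert j (copy B).1).1; move: (compute_Tbar _ _ _ _) => [T t] /= [-> tT].
  split=> [U||]; try lia.
  by rewrite map_rcons cat_rcons in_cons aE !mem_cat in_cons orbCA.
have [mE sz mt] : [/\ (for_each Bs body [::]).1 =i
    flatten [seq [seq Tbar R A C (j |: B) | j <- enum 'I_r & j \notin B] | B <- Bs],
    size (for_each Bs body [::]).1 <= size Bs * r &
    (for_each Bs body [::]).2 <= size Bs * (1 + r * (3 + r + Tbar_bound))].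
  apply: (@for_each_ind _ _ body (fun d acc k => [/\ acc =i
    flatten [seq [seq Tbar R A C (j |: B) | j <- enum 'I_r & j \notin B] | B <- d],
    size acc <= size d * r & k <= size d * (1 + r * (3 + r + Tbar_bound))])) => //.
  move=> d B d' acc k _ [aE sz kd]; have := inner B acc;
    move: (body B acc) => [acc' t] /= [aE' sz' tB].
  rewrite size_rcons !mulSn; split; [|by lia|by move: kd tB; move: (_ * _) (size d * _) => x y;
    lia].
  by move=> T; rewrite aE' map_rcons -cats1 flatten_cat /= cats0 !mem_cat aE orbC.
split=> // T; rewrite mE; split=> [/flattenP[s /mapP[B BBs ->] /mapP[j]]|[B [j [BBs jB ->]]]].
  by rewrite mem_filter => /andP[jB _] ->; exists B, j.
apply/flattenP; exists [seq Tbar R A C (j |: B) | j <- enum 'I_r & j \notin B]; first exact: map_f.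
by apply/mapP; exists j; rewrite // mem_filter jB mem_enum.
Qed.

(** The computed list may be ordered differently from the layer of the tree; agreement of members
    suffices, as the length is bounded separately. *)
Lemma eq_closed_layer tau (Bs : seq {set 'I_r}) : Bs =i closed_layer R A C tau ->
  (next_closed_layer gr A C Bs).1 =i closed_layer R A C tau.+1.
Proof.
move=> BsE T; have [mP _ _] := next_closed_layerP Bs.
apply/idP/mem_closed_layerS => [/mP|] [B [j [BB jB ->]]]; last apply/mP;
  by exists B, j; rewrite ?BsE // -BsE.
Qed.

Hypothesis r0 : 0 < r.
Hypothesis full : grank R (col_mx A C) = n.

Lemma closed_layersP tau :
  let m := for_each (iota 0 tau) (fun _ Bs => next_closed_layer gr A C Bs) [:: Tbar R A C set0] in
  [/\ m.1 =i closed_layer R A C tau, size m.1 <= r ^ tau &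
      m.2 <= tau * (1 + r ^ tau * (4 + r + Tbar_bound))].
Proof.
cbv zeta; set body := (X in for_each _ X).
suff: [/\ (for_each (iota 0 tau) body [:: Tbar R A C set0]).1 =i closed_layer R A C (size (iota
  0 tau)),
    size (for_each (iota 0 tau) body [:: Tbar R A C set0]).1 <= r ^ size (iota 0 tau) &
    (for_each (iota 0 tau) body [:: Tbar R A C set0]).2 <=
      size (iota 0 tau) * (1 + r ^ tau * (4 + r + Tbar_bound))].
  by rewrite size_iota.
apply: (@for_each_ind _ _ body (fun d Bs k => [/\ Bs =i closed_layer R A C (size d),
  size Bs <= r ^ size d & k
    <= size d * (1 + r ^ tau * (4 + r + Tbar_bound))])) => [|d x d' Bs k dE [BsE sz kd]].
  by [].
have dtau : (size d).+1 <= tau.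
  by rewrite -(size_iota 0 tau) dE size_cat /=; lia.
have := next_closed_layerP Bs; rewrite /body size_rcons => -[_ sz' t'].
split; first exact: eq_closed_layer.
  by rewrite expnSr; apply: leq_trans sz' _; rewrite leq_mul2r sz orbT.
rewrite mulSn; have szr : size Bs * r <= r ^ tau.
  by apply: leq_trans (leq_pexp2l r0 dtau); rewrite expnSr leq_mul2r sz orbT.
(* Each set has at most [r] children, so a layer of at most [r ^ size d] sets needs at most
   [r ^ tau] closures, as [size d < tau]. *)
have : size Bs * (1 + r * (3 + r + Tbar_bound)) <= r ^ tau * (4 + r + Tbar_bound).
  apply: leq_trans (leq_mul szr (leqnn _)); rewrite -mulnA leq_mul2l; apply/orP; right; lia.
move=> layer_le; apply: leq_ltn_trans (leq_add kd t') _; move: layer_le.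
by move: (size Bs * _) (r ^ tau * _) => y z; lia.
Qed.

(** The exponent of [r] arises from the last layer: its index is one below the deficiency, and each
    of its sets comes from a closure that needs up to [r] further generic ranks. *)
Lemma compute_JmaP :
  let m := compute_Jma gr A C in
  is_Jma R A C m.1 /\
  m.2 <= (deficiency R A).+1 * (r ^ deficiency R A * (3 * G + 2 * r + 20)).
Proof.
rewrite /compute_Jma /bind; cbv beta zeta.
rewrite -[(new_empty r).1]/set0 -[(new_empty r).2]/r.
have := grE set0; have := gr_le set0; rewrite grank_set0.
move: (gr A C set0) => m0 gt gE; rewrite gE -[(minus _ _).1]/(deficiency R A) /is_Jma.
case d: (deficiency R A) => [|tau].
  by rewrite /=; split=> //; rewrite expn0; lia.
have := compute_TbarP set0; move: (compute_Tbar _ _ _ _) => mB [mBE tB_le]; rewrite mBE.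
have := closed_layersP tau; move: (for_each _ _ _) => mBs [BsE szBs tBs_le].
have := largestP mBs.1 set0; move: (largest _ _) => mT [Tin Tmax tT_le].
move: mBs.1 mBs.2 mT.1 mT.2 BsE szBs tBs_le Tin Tmax tT_le => Bs tBs T tT BsE szBs tBs_le Tin
  Tmax tT_le /=.
split.
  have [B0 B0in] : exists B0, B0 \in Bs.
    have [||B0 B0t _] := @exists_closed_layer R n r A C full set0 tau; last by exists B0;
      rewrite BsE.
      by rewrite grank_set0; move: d; rewrite /deficiency; lia.
    by move: d; rewrite /deficiency; lia.
  exists T; split=> // [|U]; last by rewrite -BsE => UBs; apply: Tmax; rewrite inE UBs orbT.
  (* If the starting set [set0] is returned, no member is larger, so [B0] is empty and equals it. *)
  move: Tin; rewrite -BsE inE => /predU1P[T0|//].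
  suff -> : T = B0 by []; apply/esym/eqP; rewrite T0 -cards_eq0 -leqn0 -(cards0 'I_r) -T0.
  by apply: Tmax; rewrite inE B0in orbT.
pose P := r ^ tau.+1; pose W := P * (3 * G + 2 * r + 20).
have P0 : 0 < P by rewrite expn_gt0 r0.
have rP : r <= P by rewrite -{1}[r]expn1 leq_pexp2l.
have Tb : Tbar_bound <= r * (2 * G + r + 7).
  by have : G <= r * G := leq_pmull G r0; rewrite /Tbar_bound; lia.
have tB_le' : mB.2 <= P * (2 * G + r + 7).
  by apply: leq_trans tB_le (leq_trans Tb _); rewrite leq_mul2r rP orbT.
have tT_le' : tT <= P * 4.
  apply: leq_trans tT_le _; apply: leq_trans (leq_mul szBs (leqnn _)) _.
  by rewrite /P expnSr -mulnA leq_mul2l; apply/orP; right; lia.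
have tBs_le' : tBs <= tau * W.
  apply: leq_trans tBs_le _; rewrite leq_mul2l; apply/orP; right.
  have : r ^ tau * (4 + r + Tbar_bound) <= P * (2 * G + r + 12).
    by rewrite /P expnSr -mulnA leq_mul2l; apply/orP; right; lia.
  have : P * (2 * G + r + 13) <= W by rewrite leq_mul2l; apply/orP; right; lia.
  by rewrite (_ : 2 * G + r + 13 = 2 * G + r + 12 + 1) ?mulnDr ?muln1; lia.
rewrite -/P -/W !mulSn; have : P * (3 * G + r + 14) <= W by rewrite leq_mul2l; apply/orP;
  right; lia.
by have : G <= P * G := leq_pmull G P0; lia.
Qed.

End Jma.

(** * Total cost of the algorithm *)

Section Algorithm.
Local Open Scope nat_scope.
Variables (R : realType) (gr : grank_procedure) (n r G : nat).
Variables (A : 'M[bool]_n) (C : 'M[bool]_(r, n)).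
Hypothesis grE : forall J : {set 'I_r}, (gr A C J).1 = grank R (colAC A C J).
Hypothesis gr_le : forall J : {set 'I_r}, (gr A C J).2 <= G.

(** The 40 comes from computing [Jre], the 4 from the final comparison, and the 22 from
    [2 * r + 20], bounded by 22 times the square of [r + n]. *)
Lemma algorithmP ks : 0 < n -> 0 < r -> grank R (col_mx A C) = n ->
    deficiency R A <= ks ->
  algorithm_output R A C (algorithm gr A C).1 /\
  (algorithm gr A C).2 <=
    r ^ ks * (3 * ks.+1 * G + (44 + 22 * ks.+1) * ((r + n) * (r + n))).
Proof.
move=> n0 r0 full dks; rewrite /algorithm /bind; cbv beta zeta.
have := compute_JreP A C n0; move: (compute_Jre A C) => m1 [is_re t1].
have := compute_JmaP grE gr_le r0 full; move: (compute_Jma gr A C) => m2 [is_ma t2].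
have := smallestP [:: m1.1] m2.1; move: (smallest _ _) => m3 [m3in m3min t3] /=.
split.
  by exists m2.1, m1.1; split=> //; apply: m3min; rewrite !inE eqxx ?orbT.
pose s := r + n; pose P := r ^ ks.
have P0 : 0 < P by rewrite expn_gt0 r0.
have sP : s * s <= P * (s * s) := leq_pmull _ P0.
have s2 : s <= s * s by rewrite leq_pmull // addn_gt0 r0.
have t2' : m2.2 <= ks.+1 * (P * (3 * G + 22 * (s * s))).
  apply: leq_trans t2 _; apply: leq_mul; first by rewrite ltnS.
  by apply: leq_mul; [exact: leq_pexp2l|rewrite /s; move: s2; rewrite /s; lia].
have t1' : m1.2 <= P * (40 * (s * s)).
  by apply: leq_trans t1 _; rewrite -/s -mulnA leq_pmull.
have t3' : m3.2 <= P * (4 * (s * s)).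
  apply: leq_trans t3 _; apply: leq_trans (leq_pmull _ P0).
  by move: s2; rewrite /s /=; lia.
rewrite -/P -/s; have -> : P * (3 * ks.+1 * G + (44 + 22 * ks.+1) * (s * s)) =
    P * (40 * (s * s)) + (ks.+1 * (P * (3 * G + 22 * (s * s))) + P * (4 * (s * s))).
  by move: (s * s) => q; ring.
by rewrite leq_add // leq_add.
Qed.

End Algorithm.

Theorem theorem5 (R : realType) (gr : grank_procedure) (c : R)
  (gr_correct : forall (n r : nat) (A : 'M[bool]_n) (C : 'M[bool]_(r, n))
     (J : {set 'I_r}), (0 < n)%N ->
     result (gr n r A C J) = grank R (colAC A C J))
  (gr_time : forall (n r : nat) (A : 'M[bool]_n) (C : 'M[bool]_(r, n))
     (J : {set 'I_r}), (0 < n)%N ->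
     (time (gr n r A C J))%:R <= c * (r + n)%:R `^ (2373%:R / 1000%:R))
  (ks : nat) :
  exists K : R,
    forall (n r : nat) (A : 'M[bool]_n) (C : 'M[bool]_(r, n)),
      (0 < n)%N ->
      struct_observable R A C ->
      (forall i : 'I_r, exists j : 'I_n, C i j) ->
      (deficiency R A <= ks)%N ->
      [/\ forall J : {set 'I_r}, algorithm_output R A C J -> optimal R A C J,
          algorithm_output R A C (result (algorithm gr A C))
        & (time (algorithm gr A C))%:R
            <= K * ((r + n)%:R `^ (2373%:R / 1000%:R) * r%:R ^+ ks)].
Proof.
(* The first summand pays for the generic ranks, the second for all other steps. *)
exists ((3 * ks.+1)%N%:R * c + (44 + 22 * ks.+1)%N%:R) => n r A C n0 obs _ dks.
have [reach full] := (struct_observableP R A C).1 obs.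
(* Some state exists and reaches an output. *)
have r0 : (0 < r)%N.
  by have [_ [y _]] := reach (Ordinal n0); exact: leq_ltn_trans (leq0n y) (ltn_ord y).
pose G := (\max_(J : {set 'I_r}) time (gr n r A C J))%N.
have grE J : (gr n r A C J).1 = grank R (colAC A C J) by exact: gr_correct.
have gr_le J : ((gr n r A C J).2 <= G)%N by exact: (leq_bigmax (F := fun J => time (gr n r A C J))).
have [out_alg time_alg] := algorithmP grE gr_le n0 r0 full dks.
split=> // [J|]; first exact: output_optimal.
set p := _ `^ _.
(* The maximum [G] is attained at some sensor set, so the bound for a single call applies to it. *)
have Gp : G%:R <= c * p.
  have [|J0] := @bigop.eq_bigmax {set 'I_r} (fun J => time (gr n r A C J));
    last by rewrite /G => ->; exact: gr_time.
  by apply/card_gt0P; exists set0.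
have s1 : 1 <= (r + n)%:R :> R by rewrite ler1n addn_gt0 r0.
(* The exponent is at least 2 and the base at least 1, which absorbs the quadratic term. *)
have sp : ((r + n) * (r + n))%:R <= p.
  rewrite natrM -expr2 -powR_mulrn ?ler0n //; apply: ler_powR => //.
  by rewrite ler_pdivlMr ?ltr0n // -natrM ler_nat.
have : (time (algorithm gr A C))%:R <=
    (r ^ ks * (3 * ks.+1 * G + (44 + 22 * ks.+1) * ((r + n) * (r + n))))%N%:R :> R.
  by rewrite ler_nat.
move: (3 * ks.+1)%N (44 + 22 * ks.+1)%N ((r + n) * (r + n))%N sp => a b q sp.
move/le_trans; apply; rewrite natrM natrX natrD [(a * G)%:R]natrM [(b * q)%:R]natrM.
rewrite [leLHS]mulrC mulrA ler_wpM2r ?exprn_ge0 ?ler0n // mulrDl -mulrA.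
by rewrite lerD // ler_wpM2l ?ler0n.
Qed.
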